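(* Let $A \subseteq \omega$ be a computably enumerable set such that $A <_T \emptyset'$. Let $\delta$ be a partial $A$-computable function from $\omega$ to $\omega$ that is fixed point free, i.e. for every $n$, if $\delta(n)\downarrow$ then $W_{\delta(n)} \neq W_n$. Then for every partial computable function $\psi$ from $\omega$ to $\omega$ there exists a (total) computable function $f : \omega \to \omega$ such that for every $n \in \omega$: \begin{align*} \psi(n)\downarrow \; &\Longrightarrow \; W_{f(n)} = W_{\psi(n)},\\ \psi(n)\uparrow \; &\Longrightarrow \; \delta(f(n))\uparrow. \end{align*}
   Context: $\omega$ denotes the set of natural numbers. $\varphi_e$ denotes the $e$-th partial computable function in a fixed standard (acceptable) numbering of the unary partial computable functions, and $W_e = \mathrm{dom}(\varphi_e)$ is the $e$-th computably enumerable set. For a partial function $\alpha$, $\alpha(n)\downarrow$ means that $\alpha$ is defined at $n$, and $\alpha(n)\uparrow$ that it is undefined at $n$. $\emptyset'$ is the halting set. $A <_T \emptyset'$ means $A \leq_T \emptyset'$ and $\emptyset' \not\leq_T A$, where $\leq_T$ is Turing reducibility. A partial function is partial $A$-computable if it is computed by an oracle Turing machine with oracle $A$. *)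

(* Defs.v *)
From Stdlib Require Cantor.
From mathcomp Require Import all_boot ssralg ssrint.
From mathcomp Require Import boolp classical_sets.

Set Implicit Arguments.
Unset Strict Implicit.
Unset Printing Implicit Defensive.

Local Open Scope classical_set_scope.

(* A partial function is a map into [option nat], [None] meaning undefined.
   No computability is implied by this encoding: under classical logic every
   partial function arises in this way. *)
Definition pfun := nat -> option nat.

Definition pfun_of (f : nat -> nat) : pfun := fun n => Some (f n).

(* ** Oracle Turing machines

   Multitape machines over the tape alphabet {blank, stroke} ([false] and
   [true]), with an additional read-only oracle tape on which the
   characteristic function of the oracle is written in cells 0, 1, 2, ...;
   the cells to the left of cell 0 are blank. *)

Inductive move := Left | Stay | Right.

(* Since the states and the tuples of scanned symbols form finite types, an
   arbitrary function is a legitimate (finite) transition table. *)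
Record machine := Machine {
  state : finType;
  start : state;
  extra : nat;  (* there are [extra.+1] work tapes *)
  trans : state -> option bool -> {ffun 'I_extra.+1 -> bool} ->
          option (state * {ffun 'I_extra.+1 -> bool * move} * move)
}.

(* [(l, r)] is a two-way infinite tape: [r] starts with the scanned cell and
   goes rightwards, [l] starts just left of it and goes leftwards; all cells
   beyond these lists are blank. *)
Definition tape : Type := seq bool * seq bool.

Definition read (t : tape) : bool := head false t.2.

Definition write (b : bool) (t : tape) : tape := (t.1, b :: behead t.2).

Definition shift (m : move) (t : tape) : tape :=
  match m with
  | Left => (behead t.1, head false t.1 :: t.2)
  | Stay => t
  | Right => (head false t.2 :: t.1, behead t.2)
  end.

Definition strokes (t : tape) : nat := count id t.1 + count id t.2.

Definition shift_pos (m : move) (z : int) : int :=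
  match m with
  | Left => (z - 1)%R
  | Stay => z
  | Right => (z + 1)%R
  end.

Definition oracle_symbol (A : set nat) (z : int) : option bool :=
  if z is Posz n then Some (n \in A) else None.

Record config (M : machine) := Config {
  cur : state M;
  work : {ffun 'I_(extra M).+1 -> tape};
  opos : int  (* position of the head on the oracle tape *)
}.

(* [None] means that the machine has halted. *)
Definition step (M : machine) (A : set nat) (c : config M) :
    option (config M) :=
  if trans (cur c) (oracle_symbol A (opos c)) [ffun i => read (work c i)]
    is Some (q, w, m)
  then Some (Config q [ffun i => shift (w i).2 (write (w i).1 (work c i))]
                    (shift_pos m (opos c)))
  else None.

Fixpoint run (M : machine) (A : set nat) (s : nat) (c : config M) :
    option (config M) :=
  if s is s'.+1 then obind (run A s') (step A c) else Some c.

(* The input x is written as x + 1 consecutive strokes on work tape 0, with the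
   head on the leftmost one. *)
Definition init (M : machine) (x : nat) : config M :=
  Config (start M)
         [ffun i => if i == ord0 then ([::], nseq x.+1 true) else ([::], [::])]
         0%R.

(* The output is the total number of strokes on work tape 0 upon halting. *)
Definition outputs (M : machine) (A : set nat) (x y : nat) : Prop :=
  exists s (c : config M),
    [/\ run A s (init M x) = Some c, step A c = None
      & strokes (work c ord0) = y].

Definition computes (M : machine) (A : set nat) (f : pfun) : Prop :=
  forall x y, f x = Some y <-> outputs M A x y.

(* ** Computability notions *)

Definition partial_computable_in (A : set nat) (f : pfun) : Prop :=
  exists M : machine, computes M A f.

(* With the empty oracle, the oracle tape carries no information. *)
Definition partial_computable (f : pfun) : Prop := partial_computable_in set0 f.

Definition computable (f : nat -> nat) : Prop := partial_computable (pfun_of f).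

Definition partial_computable2 (g : nat -> pfun) : Prop :=
  partial_computable (fun z => let: (e, x) := Cantor.of_nat z in g e x).

Definition turing_le (B A : set nat) : Prop :=
  partial_computable_in A (pfun_of (fun n => nat_of_bool (n \in B))).

Definition turing_lt (A B : set nat) : Prop := turing_le A B /\ ~ turing_le B A.

(* ** Numberings *)

(* [phi e] is the e-th partial function. A numbering of the unary partial
   computable functions is acceptable iff it satisfies the enumeration theorem
   and the parametrization (s-m-n) theorem. These two conditions imply that
   every [phi e] is partial computable and that every partial computable
   function is some [phi e]. *)
Record acceptable (phi : nat -> pfun) : Prop := Acceptable {
  acceptable_enum : partial_computable2 phi;
  acceptable_smn : forall g : nat -> pfun, partial_computable2 g ->
    exists2 s : nat -> nat, computable s & forall e, phi (s e) = g e
}.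

Definition W (phi : nat -> pfun) (e : nat) : set nat :=
  [set x | phi e x <> None].

Definition ce (phi : nat -> pfun) (A : set nat) : Prop :=
  exists e, A = W phi e.

Definition halting_set (phi : nat -> pfun) : set nat :=
  [set e | W phi e e].

Definition fixed_point_free (phi : nat -> pfun) (delta : pfun) : Prop :=
  forall n m, delta n = Some m -> W phi m <> W phi n.

(* Main.v *)
(* Replace [delta] by its approximations [delta_s], run for [s] steps with the
   oracle enumerated by stage [s], and let [K] be the halting set. By the
   recursion theorem with parameters there is a computable [F (n, x)] whose set
   waits for the first stage [s] at which one of the following happens, where
   [delta_s (F (n, x))] is given no more steps than had passed when [psi n]
   converged: either [psi n] has converged and [delta_s (F (n, x))] is
   undefined, and then it copies [W_(psi n)]; or [x] has entered [K] and
   [delta_s (F (n, x))] is defined, and then it copies [W_(delta_s (F (n, x)))].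

   If [x] is not in [K] and [F (., x)] is not as required, then for some [n]
   nothing ever happens and [delta (F (n, x))] is defined by a computation that
   is no longer than the delay before [psi n] converges. Conversely, once such a
   computation, correct for the oracle [A], is present and nothing has happened
   so far, [x] cannot enter [K] any more: otherwise [F (n, x)] and
   [delta (F (n, x))] would be indices of the same set. Hence if no [x] outside
   [K] works, then [A] decides [K]: search for a stage at which [x] is in [K], or
   for such an [n] and an [A]-correct computation. *)
Require Import Defs.
From Stdlib Require Cantor.
From mathcomp Require Import all_boot ssralg ssrint zify.
From mathcomp Require Import boolp classical_sets.

Set Implicit Arguments.
Unset Strict Implicit.
Unset Printing Implicit Defensive.

(** * Programs on tapes and their compilation *)

Lemma run_add (M : machine) A m n (c : config M) :
  run A (m + n) c = obind (run A n) (run A m c).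
Proof. by elim: m c => [//|m IH] c /=; case: (step A c). Qed.

Lemma run_halted (M : machine) A m n (c d : config M) :
  run A m c = Some d -> step A d = None -> m < n -> run A n c = None.
Proof.
move=> cd d0 lt_mn; rewrite -(subnKC (ltnW lt_mn)) run_add cd /=.
by move: lt_mn; rewrite -subn_gt0; case: (n - m) => //= k _; rewrite d0.
Qed.

(** Tapes are indexed by all naturals, so that programs compose without a fixed number of tapes.
    Compilation keeps only the first ones. *)
Definition store : Type := (nat -> tape) * int.

(** Every machine step rewrites the scanned cell of each tape, which may turn an implicit blank into
    an explicit one. *)
Definition touch (t : tape) : tape := write (read t) t.

Definition touch_all (x : store) : store := (fun i => touch (x.1 i), x.2).

Definition action : Type := bool -> option bool -> bool * move * move.

Definition guard : Type := bool -> option bool -> bool.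

Inductive prog :=
| Op (r : nat) (a : action)
| Seq (p q : prog)
| While (r : nat) (g : guard) (p : prog).

Definition op_store A (r : nat) (a : action) (x : store) : store :=
  let w := a (read (x.1 r)) (oracle_symbol A x.2) in
  (fun i => if i == r then shift w.1.2 (write w.1.1 (x.1 i))
            else touch (x.1 i),
   shift_pos w.2 x.2).

Definition test A (r : nat) (g : guard) (x : store) : bool :=
  g (read (x.1 r)) (oracle_symbol A x.2).

(** The occurrences of [touch_all] account for the test and the backward jump of a loop, each of
    which is a step of the compiled machine. *)
Inductive exec A : prog -> store -> store -> Prop :=
| exec_op r a x : exec A (Op r a) x (op_store A r a x)
| exec_seq p q x y z : exec A p x y -> exec A q y z -> exec A (Seq p q) x z
| exec_stop r g p x :
    test A r g x = false -> exec A (While r g p) x (touch_all x)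
| exec_loop r g p x y z :
    test A r g x -> exec A p (touch_all x) y ->
    exec A (While r g p) (touch_all y) z -> exec A (While r g p) x z.

(* An instruction acts on one work tape and on the oracle head, and names the
   address of the next instruction. *)
Definition instr : Type :=
  nat * (bool -> option bool -> bool * move * move * nat).

Fixpoint len (p : prog) : nat :=
  match p with
  | Op _ _ => 1
  | Seq p q => len p + len q
  | While _ _ p => (len p).+2
  end.

Definition op_instr (r : nat) (a : action) (o : nat) : instr :=
  (r, fun b s => (a b s, o.+1)).

Definition test_instr (r : nat) (g : guard) (o o' : nat) : instr :=
  (r, fun b s => (b, Stay, Stay, if g b s then o.+1 else o')).

Definition jump_instr (o : nat) : instr := (0, fun b s => (b, Stay, Stay, o)).

Fixpoint compile (p : prog) (o : nat) : seq instr :=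
  match p with
  | Op r a => [:: op_instr r a o]
  | Seq p q => compile p o ++ compile q (o + len p)
  | While r g p =>
      test_instr r g o (o + (len p).+2) :: rcons (compile p o.+1) (jump_instr o)
  end.

Fixpoint tapes (p : prog) : nat :=
  match p with
  | Op r _ => r
  | Seq p q => maxn (tapes p) (tapes q)
  | While r _ p => maxn r (tapes p)
  end.

Lemma size_compile p o : size (compile p o) = len p.
Proof.
elim: p o => [//|p IHp q IHq|r g p IH] o /=; first by rewrite size_cat IHp IHq.
by rewrite size_rcons IH.
Qed.

Definition at_code (C : seq instr) o l := exists c1 c2, C = c1 ++ l ++ c2 /\ size c1 = o.

Lemma at_cat C o l1 l2 :
  at_code C o (l1 ++ l2) -> at_code C o l1 /\ at_code C (o + size l1) l2.
Proof.
case=> c1 [c2 [-> <-]]; split; first by exists c1, (l2 ++ c2); rewrite !catA.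
by exists (c1 ++ l1), c2; rewrite !catA size_cat.
Qed.

Lemma at_cons C o i l : at_code C o (i :: l) -> onth C o = Some i /\ at_code C o.+1 l.
Proof.
rewrite -cat1s => /at_cat [[c1 [c2 [-> <-]]] Cl]; rewrite addn1 in Cl; split=> //.
by rewrite onth_cat ltnn subnn.
Qed.

Section Machine.
Variables (C : seq instr) (K : nat).

(** The state is a program counter. The address [size C] carries no instruction, so the machine
    halts there. *)
Definition tm : machine := @Machine ('I_(size C).+1 : finType) ord0 K
  (fun q s rd =>
     if onth C q is Some (r, f) then
       let: (w, m, m', o) := f (rd (inord r)) s in
       Some (inord o, [ffun i : 'I_K.+1 =>
                         if i == r :> nat then (w, m) else (rd i, Stay)], m')
     else None).

Definition cfg (o : nat) (x : store) : config tm :=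
  @Config tm (inord o) [ffun i : 'I_K.+1 => x.1 i] x.2.

Lemma step_cfg A o r f (x : store) :
  onth C o = Some (r, f) -> r <= K ->
  let w := f (read (x.1 r)) (oracle_symbol A x.2) in
  step A (cfg o x) = Some (cfg w.2 (op_store A r (fun b s => (f b s).1) x)).
Proof.
move=> Co leK w; have lto : o < size C by rewrite -onthTE Co.
rewrite /step /cfg /= inordK ?ltnS 1?ltnW // Co !ffunE inordK ?ltnS //.
rewrite -/w /op_store -/w; case: w => [[[w m] m'] o'] /=.
congr (Some (Config _ _ _)); apply/ffunP => i; rewrite !ffunE /=.
by case: eqP => // ->.
Qed.

Lemma step_end A x : step A (cfg (size C) x) = None.
Proof. by rewrite /step /= inordK // onth_default. Qed.

Lemma step_op A o r a l x :
  at_code C o (op_instr r a o :: l) -> r <= K ->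
  step A (cfg o x) = Some (cfg o.+1 (op_store A r a x)).
Proof. by move=> /at_cons [Co _] leK; rewrite (step_cfg _ _ Co leK). Qed.

Lemma stay_store A r (f : bool -> option bool -> nat) x :
  op_store A r (fun b s => (b, Stay, Stay, f b s).1) x = touch_all x.
Proof.
by rewrite /op_store /touch_all; congr pair; apply/funext => i; case: eqP => [->|].
Qed.

Lemma step_test A o r g o' l x :
  at_code C o (test_instr r g o o' :: l) -> r <= K ->
  step A (cfg o x) = Some (cfg (if test A r g x then o.+1 else o') (touch_all x)).
Proof.
by move=> /at_cons [Co _] leK; rewrite (step_cfg _ _ Co leK) stay_store.
Qed.

Lemma step_jump A o o' x :
  at_code C o [:: jump_instr o'] -> step A (cfg o x) = Some (cfg o' (touch_all x)).
Proof.
move=> /at_cons [Co _].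
by rewrite (step_cfg _ _ Co (leq0n K)) (stay_store A 0 (fun _ _ => o')).
Qed.

Lemma exec_run A p x y : exec A p x y ->
  forall o, at_code C o (compile p o) -> tapes p <= K ->
  exists n, run A n (cfg o x) = Some (cfg (o + len p) y).
Proof.
elim=> {p x y}.
- move=> r a x o Co leK; exists 1; rewrite /= (step_op _ _ Co leK) /=.
  by rewrite addn1.
- move=> p q x y z _ IHp _ IHq o /= /at_cat [Cp]; rewrite size_compile => Cq.
  rewrite geq_max => /andP [leKp leKq].
  have [n1 R1] := IHp o Cp leKp; have [n2 R2] := IHq _ Cq leKq.
  by exists (n1 + n2); rewrite run_add R1 /= R2 addnA.
- move=> r g p x gx o /= Co; rewrite geq_max => /andP [leK _].
  by exists 1; rewrite /= (step_test _ _ Co leK) gx.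
- move=> r g p x y z gx _ IHp _ IHw o Co leK'.
  have := Co; rewrite /= -cats1 => /at_cons [_ /at_cat [Cp]]; rewrite size_compile => Cj.
  have := leK'; rewrite /= geq_max => /andP [leK leKp].
  have [n1 R1] := IHp _ Cp leKp; have [n2 R2] := IHw _ Co leK'.
  exists (n1 + n2.+1).+1; rewrite /= (step_test _ _ Co leK) gx /= run_add R1 /=.
  by rewrite (step_jump _ _ Cj) /= R2.
Qed.

(** This serves to prove divergence: an invariant that keeps the test true yields runs of arbitrary
    length, which a halting computation excludes. *)
Lemma loop_run A r g p (I : store -> Prop) :
  (forall x, I x -> test A r g x /\
     exists2 y, exec A p (touch_all x) y & I (touch_all y)) ->
  forall o x, at_code C o (compile (While r g p) o) -> tapes (While r g p) <= K -> I x ->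
  forall m, exists n c, m <= n /\ run A n (cfg o x) = Some c.
Proof.
move=> Ig o x Co leK' Ix m; elim: m x Ix => [|m IH] x Ix.
  by exists 0, (cfg o x).
have [gx [y xy Iy]] := Ig _ Ix; have [n2 [c [len2 R2]]] := IH _ Iy.
have := Co; rewrite /= -cats1 => /at_cons [_ /at_cat [Cp]]; rewrite size_compile => Cj.
have := leK'; rewrite /= geq_max => /andP [leK leKp].
have [n1 R1] := exec_run xy Cp leKp.
exists (n1 + n2.+1).+1, c; split.
  by rewrite ltnS addnS leqW // (leq_trans len2) // leq_addl.
rewrite /= (step_test _ _ Co leK) gx /= run_add R1 /=.
by rewrite (step_jump _ _ Cj) /= R2.
Qed.

End Machine.

(* Register [r] holding [v] is work tape [r] with [v] strokes from the head
   rightwards; the blanks around them are immaterial. *)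
Definition holds (t : tape) (v : nat) : Prop :=
  exists i j, t = (nseq i false, nseq v true ++ nseq j false).

Definition regs : Type := nat -> nat.

Definition represents (x : store) (st : regs) (z : int) : Prop :=
  x.2 = z /\ forall r, holds (x.1 r) (st r).

Definition upd (st : regs) r v : regs := fun i => if i == r then v else st i.

Lemma holds_touch t v : holds t v -> holds (touch t) v.
Proof.
case=> i [j ->]; case: v => [|v]; last by exists i, j.
by case: j => [|j]; [exists i, 1 | exists i, j.+1].
Qed.

Lemma repr_touch x st z : represents x st z -> represents (touch_all x) st z.
Proof. by case=> x2 H; split=> // r; apply: holds_touch. Qed.

Lemma holds_read t v : holds t v -> read t = (v > 0).
Proof. by case=> i [j ->]; case: v => //; case: j. Qed.

Definition does A p st z st' z' :=
  forall x, represents x st z -> exists2 y, exec A p x y & represents y st' z'.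

Lemma does_seq A p q st1 z1 st2 z2 st3 z3 :
  does A p st1 z1 st2 z2 -> does A q st2 z2 st3 z3 ->
  does A (Seq p q) st1 z1 st3 z3.
Proof.
move=> Hp Hq x /Hp [y xy /Hq [w yw Hw]]; exists w => //; exact: exec_seq xy yw.
Qed.

Lemma test_repr A r g x st z :
  represents x st z -> test A r g x = g (0 < st r) (oracle_symbol A z).
Proof. by case=> <- H; rewrite /test (holds_read (H r)). Qed.

Lemma does_stop A r (g : guard) p st z :
  g (0 < st r) (oracle_symbol A z) = false -> does A (While r g p) st z st z.
Proof.
move=> g0 x Hx; exists (touch_all x); last exact: repr_touch.
by apply: exec_stop; rewrite (test_repr _ _ _ Hx).
Qed.

Lemma does_loop A r (g : guard) p st1 z1 st2 z2 st3 z3 :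
  g (0 < st1 r) (oracle_symbol A z1) -> does A p st1 z1 st2 z2 ->
  does A (While r g p) st2 z2 st3 z3 -> does A (While r g p) st1 z1 st3 z3.
Proof.
move=> g1 Hp Hw x Hx.
have [y xy /repr_touch Hy] := Hp _ (repr_touch Hx); have [w yw Hw'] := Hw _ Hy.
by exists w => //; apply: exec_loop xy yw; rewrite (test_repr _ _ _ Hx).
Qed.

(** The block of strokes grows and shrinks at its left end, where the head stands. *)
Definition Inc r : prog :=
  Seq (Op r (fun b _ => (b, Left, Stay))) (Op r (fun _ _ => (true, Stay, Stay))).

Lemma does_inc A r st z : does A (Inc r) st z (upd st r (st r).+1) z.
Proof.
move=> x [x2 H]; eexists; first by apply: exec_seq; apply: exec_op.
split=> //= i; rewrite /upd; case: eqP => [->|_]; last by do 2!apply: holds_touch.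
have [j [k Ht]] := holds_touch (H r).
move: Ht; rewrite /touch /write /= => -[-> ->].
by exists j.-1, k; case: j.
Qed.

Definition Dec r : prog :=
  Op r (fun b _ => (false, if b then Right else Stay, Stay)).

Lemma does_dec A r st z : does A (Dec r) st z (upd st r (st r).-1) z.
Proof.
move=> x [x2 H]; eexists; first exact: exec_op.
split=> //= i; rewrite /upd; case: eqP => [->|_]; last exact: holds_touch.
rewrite (holds_read (H r)); have [j [k ->]] := H r.
case: (st r) => [|v] /=; last by exists j.+1, k.
by exists j, k.-1.+1; case: k.
Qed.

Definition OMove m : prog := Op 0 (fun b _ => (b, Stay, m)).

Lemma does_omove A m st z : does A (OMove m) st z st (shift_pos m z).
Proof.
move=> x [x2 H]; eexists; first exact: exec_op.
split=> //=; first by rewrite x2.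
by move=> i; case: eqP => [->|_]; apply: holds_touch.
Qed.

Definition nonzero : guard := fun b _ => b.

Lemma upd_upd st r u v : upd (upd st r u) r v = upd st r v.
Proof. by apply/funext => i; rewrite /upd; case: eqP. Qed.

Lemma upd_same st r v : st r = v -> upd st r v = st.
Proof. by move=> <-; apply/funext => i; rewrite /upd; case: eqP => [->|]. Qed.

(* The oracle head is moved right, to the cell given by the register, then back
   to cell 0, which is recognized from the absence of a symbol at cell -1. *)
Definition Query r q : prog :=
  Seq (While r nonzero (Seq (Dec r) (OMove Right)))
  (Seq (While q (fun b s => ~~ b && (s == Some true)) (Inc q))
  (Seq (While 0 (fun _ s => s) (OMove Left)) (OMove Right))).

Lemma does_query A r q st : r != q -> st q = 0 ->
  does A (Query r q) st 0%R (upd (upd st r 0) q (st r \in A)) 0%R.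
Proof.
move=> neq_rq stq; apply: (@does_seq _ _ _ _ _ (upd st r 0) (Posz (st r))).
  suff H v (p : nat) s : s r = v ->
      does A (While r nonzero (Seq (Dec r) (OMove Right))) s p (upd s r 0) (p + v)%N.
    exact: (H _ 0).
  elim: v p s => [|v IH] p s sr.
    by rewrite addn0 upd_same //; apply: does_stop; rewrite sr.
  apply: (@does_loop _ _ _ _ _ _ (upd s r v) (Posz p.+1)); first by rewrite sr.
    have := @does_seq A _ _ _ _ _ _ _ _ (@does_dec A r s p)
      (@does_omove A Right _ p).
    by rewrite sr /= -PoszD addn1.
  rewrite addnS -addSn -[upd s r 0](upd_upd _ _ v); apply: IH.
  by rewrite /upd eqxx.
set st1 := upd st r 0.
have st1q : st1 q = 0 by rewrite /st1 /upd eq_sym (negbTE neq_rq).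
apply: (@does_seq _ _ _ _ _ (upd st1 q (st r \in A)) (Posz (st r))).
  case rA: (st r \in A); last first.
    rewrite upd_same //; apply: does_stop; by rewrite /= rA andbF.
  apply: (@does_loop _ _ _ _ _ _ (upd st1 q 1) (Posz (st r))).
  - by rewrite st1q /= rA.
  - have := @does_inc A q st1 (st r); by rewrite st1q.
  - by apply: does_stop; rewrite /upd eqxx.
apply: (@does_seq _ _ _ _ _ _ (Negz 0)); last exact: (@does_omove _ Right _ (Negz 0)).
move: (st r) (upd _ _ _) => n s; elim: n => [|n IH].
  apply: (@does_loop _ _ _ _ _ _ s (Negz 0)) => //; last exact: does_stop.
  exact: (@does_omove _ Left s (Posz 0)).
apply: does_loop IH => //.
have := @does_omove A Left s (Posz n.+1); by rewrite /= -addn1 PoszD GRing.addrK.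
Qed.

(** * Functions evaluated by programs on registers *)

Definition doesr A p st st' := does A p st 0%R st' 0%R.

Lemma doesr_seq A p q st1 st2 st3 :
  doesr A p st1 st2 -> doesr A q st2 st3 -> doesr A (Seq p q) st1 st3.
Proof. exact: does_seq. Qed.

Lemma doesr_eq A p st st1 st2 : doesr A p st st1 -> st1 = st2 -> doesr A p st st2.
Proof. by move=> H <-. Qed.

(** The invariant is indexed by the value still left in the counter, hence it runs downwards. *)
Lemma does_for A r p (inv : nat -> regs) n :
  (forall m, m <= n -> inv m r = m) ->
  (forall m, m < n -> doesr A p (inv m.+1) (inv m)) ->
  doesr A (While r nonzero p) (inv n) (inv 0).
Proof.
elim: n => [|n IH] Hr Hp; first by apply: does_stop; rewrite Hr.
apply: (does_loop _ (Hp n _)) => //; first by rewrite Hr.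
by apply: IH => m lm; [apply: Hr | apply: Hp]; rewrite ?leqW.
Qed.

Lemma upd_at st r v : upd st r v r = v.
Proof. by rewrite /upd eqxx. Qed.

Ltac upd_tac := apply/funext => ?; rewrite /upd; repeat case: eqP; intros; subst; lia.

Definition Clear r : prog := While r nonzero (Dec r).

Lemma does_clear A r st : doesr A (Clear r) st (upd st r 0).
Proof.
rewrite -{1}[st](@upd_same _ r (st r)) //.
apply: (does_for (inv := fun n => upd st r n)) => [|m _]; first by rewrite /upd eqxx.
by apply: doesr_eq; [apply: does_dec | upd_tac].
Qed.

Definition Mv r a : prog := While r nonzero (Seq (Dec r) (Inc a)).

Lemma does_mv A r a st : r != a ->
  doesr A (Mv r a) st (upd (upd st r 0) a (st a + st r)).
Proof.
move=> /eqP ra; pose inv n := upd (upd st r n) a (st a + (st r - n)).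
apply: (@doesr_eq _ _ _ (inv 0)); last by rewrite /inv; upd_tac.
rewrite -{1}[st](_ : inv (st r) = st); last by rewrite /inv; upd_tac.
apply: does_for => m lm; first by rewrite /inv /upd; repeat case: eqP; lia.
apply: doesr_eq; first by apply: doesr_seq; [apply: does_dec | apply: does_inc].
by rewrite /inv; upd_tac.
Qed.

Definition Mv2 r a b : prog :=
  While r nonzero (Seq (Dec r) (Seq (Inc a) (Inc b))).

Lemma does_mv2 A r a b st : r <> a -> r <> b -> a <> b ->
  st a = 0 -> st b = 0 ->
  doesr A (Mv2 r a b) st (upd (upd (upd st r 0) a (st r)) b (st r)).
Proof.
move=> ra rb ab a0 b0.
pose inv n := upd (upd (upd st r n) a (st r - n)) b (st r - n).
apply: (@doesr_eq _ _ _ (inv 0)); last by rewrite /inv; upd_tac.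
rewrite -{1}[st](_ : inv (st r) = st); last by rewrite /inv; upd_tac.
apply: does_for => m lm; first by rewrite /inv /upd; repeat case: eqP; lia.
apply: doesr_eq.
  by apply: doesr_seq; [|apply: doesr_seq]; [apply: does_dec | apply: does_inc..].
by rewrite /inv; upd_tac.
Qed.

Definition scons (v : nat) (s : nat -> nat) : nat -> nat :=
  fun i => if i is j.+1 then s j else v.

(* [F] can be evaluated on the contents of any registers below [k], leaving the
   result in register [k] and using the registers from [k] on as workspace. *)
Definition def A (F : (nat -> nat) -> nat) : Prop :=
  forall rho k, (forall i, rho i < k) -> exists p, forall st,
    (forall i, k <= i -> st i = 0) ->
    doesr A p st (upd st k (F (fun i => st (rho i)))).

Section Def.
Variable A : set nat.

Lemma def_ren F s : def A F -> def A (fun e => F (fun i => e (s i))).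
Proof. by move=> dF rho k Hk; apply: (dF (fun i => rho (s i))). Qed.

(** Moving a register empties it, so the value is moved to two places and then restored from the
    second. *)
Lemma def_var i : def A (fun e => e i).
Proof.
move=> rho k Hk; exists (Seq (Mv2 (rho i) k k.+1) (Mv k.+1 (rho i))) => st Hst.
have ltk := Hk i; have k0 := Hst k (leqnn _); have k1 := Hst k.+1 (leqnSn _).
apply: doesr_eq.
  by apply: doesr_seq; [apply: does_mv2; lia | apply: does_mv; lia].
upd_tac.
Qed.

Lemma def0 : def A (fun _ => 0).
Proof. by move=> rho k Hk; exists (Clear k) => st _; apply: does_clear. Qed.

Lemma defS F : def A F -> def A (fun e => (F e).+1).
Proof.
move=> dF rho k Hk; have [p Hp] := dF rho k Hk; exists (Seq p (Inc k)) => st Hst.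
apply: doesr_eq; first by apply: doesr_seq; [apply: Hp | apply: does_inc].
upd_tac.
Qed.

Lemma upd_below (rho : nat -> nat) k st j v : (forall i, rho i < k) -> k <= j ->
  (fun i => upd st j v (rho i)) = (fun i => st (rho i)).
Proof.
by move=> Hk kj; apply/funext => i; rewrite /upd; case: eqP (Hk i) => // ->; lia.
Qed.

Lemma def_let F G : def A F -> def A G -> def A (fun e => G (scons (F e) e)).
Proof.
move=> dF dG rho k Hk; have [p Hp] := dF rho k Hk.
have Hk' i : scons k rho i < k.+1 by case: i => [|i] //=; apply: leqW.
have [q Hq] := dG (scons k rho) k.+1 Hk'.
exists (Seq p (Seq q (Seq (Clear k) (Mv k.+1 k)))) => st Hst.
apply: doesr_seq; first exact: Hp.
apply: doesr_eq.
  apply: doesr_seq; first apply: Hq.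
    by move=> i ki; rewrite /upd; case: eqP; [lia | rewrite Hst // ltnW].
  by apply: doesr_seq; [apply: does_clear | apply: does_mv; lia].
set u := upd st k _; have -> : (fun i => u (scons k rho i)) =
    scons (F (fun i => st (rho i))) (fun i => st (rho i)).
  apply/funext => -[|i]; rewrite /u /upd /= ?eqxx //.
  by case: eqP (Hk i) => // ->; lia.
have z1 := Hst k.+1 (leqnSn _); rewrite /u {u}; move: (F _) => f.
by move: (G _) => g; upd_tac.
Qed.

Lemma def_orc F : def A F -> def A (fun e => nat_of_bool (F e \in A)).
Proof.
move=> dF rho k Hk; have [p Hp] := dF rho k Hk.
exists (Seq p (Seq (Query k k.+1) (Mv k.+1 k))) => st Hst.
have k1 := Hst k.+1 (leqnSn _).
apply: doesr_seq; first exact: Hp.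
apply: doesr_eq.
  apply: doesr_seq; last by apply: does_mv; lia.
  by apply: does_query; rewrite /upd; [lia | case: eqP; lia].
by rewrite upd_at; move: (F _) (nat_of_bool _) => f b; upd_tac.
Qed.

Lemma def_rec N B S :
  def A N -> def A B -> def A (fun e => S (e 0) (e 1) (fun j => e j.+2)) ->
  def A (fun e => iteri (N e) (fun i v => S i v e) (B e)).
Proof.
move=> dN dB dS rho k Hk.
have [p Hp] := dN rho k Hk.
have Hk1 i : rho i < k.+1 by apply: leqW.
have [q Hq] := dB rho k.+1 Hk1.
have Hk3 i : scons k.+2 (scons k.+1 rho) i < k.+3.
  by case: i => [|[|i]] //=; do 3!apply: leqW.
have [s Hs] := dS _ k.+3 Hk3.
exists (Seq p (Seq q (Seq
  (While k nonzero
     (Seq (Dec k) (Seq s (Seq (Clear k.+1) (Seq (Mv k.+3 k.+1) (Inc k.+2))))))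
  (Seq (Clear k.+2) (Mv k.+1 k))))) => st Hst.
have z1 := Hst k.+1 (leqnSn _); have z2 : st k.+2 = 0 by apply: Hst; lia.
have z3 : st k.+3 = 0 by apply: Hst; lia.
apply: doesr_seq; first exact: Hp.
apply: doesr_seq.
  by apply: Hq => i ki; rewrite /upd; case: eqP; [lia | rewrite Hst // ltnW].
rewrite (upd_below _ _ Hk) //; set env := fun i => st (rho i).
set n := N env.
(* Register [k] counts down, [k.+1] holds the accumulated value, [k.+2] counts up as the recursion
   index, and [k.+3] receives the result of each step. *)
pose val j := iteri j (fun i v => S i v env) (B env).
pose inv m := upd (upd (upd st k m) k.+1 (val (n - m))) k.+2 (n - m).
apply: (@doesr_seq _ _ _ _ (inv 0)).
  have -> : upd (upd st k n) k.+1 (B env) = inv n.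
    by rewrite /inv subnn -[val 0]/(B env); upd_tac.
  apply: does_for => m lm; first by rewrite /inv /upd; repeat case: eqP; lia.
  apply: doesr_seq; first exact: does_dec.
  have -> : upd (inv m.+1) k (inv m.+1 k).-1 =
    upd (upd (upd st k m) k.+1 (val (n - m.+1))) k.+2 (n - m.+1).
    by rewrite /inv; upd_tac.
  set st1 := upd _ _ _.
  apply: doesr_eq.
    apply: doesr_seq; first apply: Hs.
      by move=> i ki; rewrite /st1 /upd; repeat case: eqP; try lia; rewrite Hst //; lia.
    apply: doesr_seq; first exact: does_clear.
    by apply: doesr_seq; [apply: does_mv; lia | apply: does_inc].
  have -> : (fun j => st1 (scons k.+2 (scons k.+1 rho) j.+2)) = env.
    by apply/funext => j /=; have := Hk j; rewrite /env /st1 /upd; repeat case: eqP; lia.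
  have -> : st1 (scons k.+2 (scons k.+1 rho) 0) = n - m.+1.
    by rewrite /st1 /upd /=; repeat case: eqP; lia.
  have -> : st1 (scons k.+2 (scons k.+1 rho) 1) = val (n - m.+1).
    by rewrite /st1 /upd /=; repeat case: eqP; lia.
  have E : S (n - m.+1) (val (n - m.+1)) env = val (n - m).
    by rewrite -[n - m]prednK ?subn_gt0 // -subnS.
  by rewrite E /st1 /inv; upd_tac.
apply: doesr_eq.
  by apply: doesr_seq; [apply: does_clear | apply: does_mv; lia].
by rewrite /inv subn0 -/(val n); upd_tac.
Qed.

End Def.

(** * Unbounded search: from definable functions to Turing machines *)

Lemma outputs_fun (M : machine) A x y y' : outputs M A x y -> outputs M A x y' -> y = y'.
Proof.
case=> [m [c [Rm cN <-]]] [n [d [Rn dN <-]]].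
case: (ltngtP m n) => [lt|lt|E].
- by rewrite (run_halted Rm cN lt) in Rn.
- by rewrite (run_halted Rn dN lt) in Rm.
- by move: Rn; rewrite -E Rm => -[->].
Qed.

Lemma strokes_holds t v : holds t v -> strokes t = v.
Proof. by case=> i [j ->]; rewrite /strokes /= count_cat !count_nseq; lia. Qed.

(** The machine tries [s = 0, 1, ...] until [R x s] is positive. The hypothesis on [f] makes all
    positive values of [R x] equal, so the first hit gives the output; without a hit the search
    never ends. *)
Lemma search_computable A (R : nat -> nat -> nat) (f : pfun) :
  def A (fun e => R (e 0) (e 1)) ->
  (forall x y, f x = Some y <-> exists s, R x s = y.+1) ->
  partial_computable_in A f.
Proof.
move=> dR fR.
have [p Hp] := dR (fun i => minn i 2) 3 (fun i => geq_minr i 2).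
pose body := Seq (Inc 1) p.
pose fin := Seq (Dec 3) (Seq (Clear 0) (Mv 3 0)).
pose loop := While 3 (fun b _ => ~~ b) body.
(* The first decrement corrects the input convention of [x + 1] strokes. *)
pose P := Seq (Dec 0) (Seq p (Seq loop fin)).
pose C := compile P 0; pose K := tapes P.
pose R0 x s v : regs := fun i => match i with 0 => x | 1 => s | 3 => v | _ => 0 end.
pose x0 x : store :=
  (fun i => if i == 0 then ([::], nseq x.+1 true) else ([::], [::]), 0%R).
have Hx0 x : represents (x0 x) (R0 x.+1 0 0) 0%R.
  split=> // -[|r] /=; first by exists 0, 0; rewrite cats0.
  by case: r => [|[|[|r]]]; exists 0, 0.
have initE x : init (tm C K) x = cfg C K 0 (x0 x).
  rewrite /init /cfg; congr (Config _ _ _); first by apply: val_inj; rewrite /= inordK.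
have pR x s : doesr A p (R0 x s 0) (R0 x s (R x s)).
  apply: doesr_eq; first by apply: Hp => -[|[|[|[|i]]]].
  by apply/funext => -[|[|[|[|i]]]].
have d0 x : doesr A (Dec 0) (R0 x.+1 0 0) (R0 x 0 0).
  by apply: doesr_eq; [apply: does_dec | apply/funext => -[|[|[|[|i]]]]].
have bR x s : doesr A body (R0 x s 0) (R0 x s.+1 (R x s.+1)).
  apply: doesr_seq; last exact: pR.
  by apply: doesr_eq; [apply: does_inc | apply/funext => -[|[|[|[|i]]]]].
have CE : at_code C 0 (compile P 0) by exists [::], [::]; rewrite cats0.
have fwd x y : f x = Some y -> outputs (tm C K) A x y.
  move=> fx; have /fR exs := fx.
  have {exs} exs : exists s, 0 < R x s by have [s Es] := exs; exists s; rewrite Es.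
  case: (ex_minnP exs) => n n0 nmin.
  have {n0} Rn : R x n = y.+1.
    case E: (R x n) n0 => [//|y'] _.
    by have /fR : exists s, R x s = y'.+1 by [exists n]; rewrite fx => -[->].
  have lR : doesr A loop (R0 x 0 (R x 0)) (R0 x n y.+1).
    have R0' m : m < n -> R x m = 0.
      by move=> lm; apply/eqP; rewrite -leqn0 leqNgt; apply: contraTN lm => /nmin; rewrite leqNgt.
    suff H k : k <= n -> doesr A loop (R0 x (n - k) (R x (n - k))) (R0 x n y.+1).
      by rewrite -(subnn n); apply: H.
    elim: k => [|k IH] lk; first by rewrite subn0 Rn; apply: does_stop.
    have Ek : n - k = (n - k.+1).+1 by lia.
    have := R0' (n - k.+1); rewrite ltn_subrL (leq_trans _ lk) // => /(_ isT) E.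
    have := IH (ltnW lk); rewrite Ek E; apply: does_loop => //; exact: bR.
  have [z xz [z2 Hz]] : exists2 z, exec A P (x0 x) z & represents z (R0 y n 0) 0%R.
    apply: (_ : doesr A P (R0 x.+1 0 0) (R0 y n 0)) => //.
    do 3![apply: doesr_seq; first by eauto].
    apply: doesr_eq.
      by do 2![apply: doesr_seq; first by [exact: does_dec|exact: does_clear]]; apply: does_mv.
    by apply/funext => -[|[|[|[|i]]]].
  have [n' Rn'] := exec_run xz CE (leqnn _).
  exists n', (cfg C K (0 + len P) z); rewrite initE; split=> //.
    by rewrite add0n -(size_compile P 0) step_end.
  by rewrite ffunE; apply: strokes_holds (Hz 0).
exists (tm C K) => x y; split=> [|out]; first exact: fwd.
case fx: (f x) => [y'|]; first by rewrite (outputs_fun out (fwd _ _ fx)).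
have R0' s : R x s = 0.
  by case E: (R x s) => [//|y']; have /fR : exists s, R x s = y'.+1 by [exists s]; rewrite fx.
have [n1 [c [Rn1 cN _]]] := out.
have [C1 C2] : at_code C 0 (compile (Dec 0) 0) /\
    at_code C 1 (compile p 1 ++ compile (Seq loop fin) (1 + len p)) := at_cat CE.
have [C3] := at_cat C2; rewrite size_compile => /at_cat [C5 _] {C2}.
have [y1 xy1 Hy1] := d0 x _ (Hx0 x); have [y2 xy2 Hy2] := pR x 0 _ Hy1.
rewrite R0' in Hy2.
have [m1 E1] := exec_run (K := K) xy1 C1 (leq0n _).
have lep : tapes p <= K by rewrite /K /=; lia.
have [m2 E2] := exec_run (K := K) xy2 C3 lep.
(* Here [f x] is undefined, so register 3 stays zero and the loop outlasts the supposed halting run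
   of [n1] steps. *)
have [|||n2 [d [len2 E3]]] := @loop_run C K A 3 (fun b _ => ~~ b) body
   (fun z => exists s, represents z (R0 x s 0) 0%R) _ _ y2 C5 _ _ n1.+1.
- move=> z [s Hz]; split; first by rewrite (test_repr _ _ _ Hz).
  have := bR x s _ (repr_touch Hz); rewrite R0' => -[w zw Hw].
  by exists w => //; exists s.+1; apply: repr_touch.
- by rewrite /K /=; lia.
- by exists 0.
have : run A (m1 + (m2 + n2)) (init (tm C K) x) = Some d.
  by rewrite run_add initE E1 /= run_add E2.
by rewrite (run_halted Rn1 cN) //; lia.
Qed.

(** * Primitive recursion and pairing *)

Section Arith.
Variable A : set nat.
Implicit Types (F G H : (nat -> nat) -> nat) (b c : (nat -> nat) -> bool).

Lemma def_ext F G : F =1 G -> def A F -> def A G.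
Proof. by move=> /funext ->. Qed.

Lemma def_app1 (g : nat -> nat) F :
  def A (fun e => g (e 0)) -> def A F -> def A (fun e => g (F e)).
Proof. by move=> dg dF; apply: (def_let dF dg). Qed.

Lemma def_app2 (g : nat -> nat -> nat) F G :
  def A (fun e => g (e 0) (e 1)) -> def A F -> def A G ->
  def A (fun e => g (F e) (G e)).
Proof.
move=> dg dF dG.
have d1 : def A (fun e => g (F (fun i => e i.+1)) (e 0)).
  exact: (def_let (def_ren succn dF) (def_ren (fun i => if i is 1 then 1 else 0) dg)).
exact: (def_let dG d1).
Qed.

Lemma def_const n : def A (fun _ => n).
Proof. by elim: n => [|n IH]; [apply: def0 | apply: defS]. Qed.

Lemma def_add F G : def A F -> def A G -> def A (fun e => F e + G e).
Proof.
move=> dF; apply: (@def_app2 addn) dF.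
apply: (def_ext (F := fun e => iteri (e 1) (fun _ v => v.+1) (e 0))) => [e|].
  by elim: (e 1) => [|n /= ->]; rewrite ?addn0 ?addnS.
by apply: def_rec; do ?apply: defS; apply: def_var.
Qed.

Lemma def_pred F : def A F -> def A (fun e => (F e).-1).
Proof.
apply: (@def_app1 predn).
apply: (def_ext (F := fun e => iteri (e 0) (fun i _ => i) 0)) => [e|].
  by case: (e 0).
by apply: def_rec; [apply: def_var | apply: def0 | apply: def_var].
Qed.

Lemma def_sub F G : def A F -> def A G -> def A (fun e => F e - G e).
Proof.
move=> dF; apply: (@def_app2 subn) dF.
apply: (def_ext (F := fun e => iteri (e 1) (fun _ v => v.-1) (e 0))) => [e|].
  by elim: (e 1) => [|n /= ->]; rewrite ?subn0 ?subnS.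
by apply: def_rec; do ?apply: def_pred; apply: def_var.
Qed.

Lemma def_mul F G : def A F -> def A G -> def A (fun e => F e * G e).
Proof.
move=> dF; apply: (@def_app2 muln) dF.
apply: (def_ext (F := fun e => iteri (e 1) (fun _ v => v + e 0) 0)) => [e|].
  by elim: (e 1) => [|n /= ->]; rewrite ?muln0 ?mulnS // addnC.
by apply: def_rec; do ?[apply: def_add|apply: def0]; apply: def_var.
Qed.

Lemma def_sum N (F : nat -> (nat -> nat) -> nat) :
  def A N -> def A (fun e => F (e 0) (fun j => e j.+1)) ->
  def A (fun e => \sum_(i < N e) F i e).
Proof.
move=> dN dF.
apply: (def_ext (F := fun e => iteri (N e) (fun i v => v + F i e) 0)) => [e|].
  by elim: (N e) => [|n /= ->]; rewrite ?big_ord0 ?big_ord_recr.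
apply: def_rec => //; first exact: def0.
apply: def_add; first exact: def_var.
exact: (def_ren (fun i => if i is j.+1 then j.+2 else 0) dF).
Qed.

Lemma defb_eq F G : def A F -> def A G -> def A (fun e => F e == G e : nat).
Proof.
move=> dF dG.
apply: (def_ext (F := fun e => 1 - ((F e - G e) + (G e - F e)))) => [e|].
  by case: eqP => [->|ne]; rewrite ?subnn /=; lia.
by do ![apply: def_sub|apply: def_add|apply: def_const].
Qed.

Lemma defb_neg b : def A (fun e => b e : nat) -> def A (fun e => ~~ b e : nat).
Proof.
move=> db; apply: (def_ext (F := fun e => 1 - b e)) => [e|]; first by case: (b e).
by apply: def_sub => //; apply: def_const.
Qed.

Lemma defb_and b c : def A (fun e => b e : nat) -> def A (fun e => c e : nat) ->
  def A (fun e => b e && c e : nat).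
Proof.
move=> db dc; apply: (def_ext (F := fun e => b e * c e)) => [e|].
  by rewrite mulnb.
exact: def_mul.
Qed.

Lemma defb_leq F G : def A F -> def A G -> def A (fun e => F e <= G e : nat).
Proof.
move=> dF dG; apply: (defb_eq (F := fun e => F e - G e)); first exact: def_sub.
exact: def_const.
Qed.

Lemma def_if b F G :
  def A (fun e => b e : nat) -> def A F -> def A G ->
  def A (fun e => if b e then F e else G e).
Proof.
move=> db dF dG.
apply: (def_ext (F := fun e => b e * F e + (~~ b e) * G e)) => [e|].
  by case: (b e) => /=; lia.
by apply: def_add; apply: def_mul => //; apply: defb_neg.
Qed.

Lemma defb_odd F : def A F -> def A (fun e => odd (F e) : nat).
Proof.
apply: (@def_app1 odd).
apply: (def_ext (F := fun e => iteri (e 0) (fun _ v => 1 - v) 0)) => [e|].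
  by elim: (e 0) => [|n /= ->]; last by case: odd.
by apply: def_rec; do ?apply: def_sub; do ?[apply: def_const|apply: def_var].
Qed.

Lemma def_half F : def A F -> def A (fun e => (F e)./2).
Proof.
apply: (@def_app1 half).
(* Half of a number, rounded down, counts the odd numbers below it. *)
apply: (def_ext (F := fun e => \sum_(i < e 0) odd i)) => [e|].
  by elim: (e 0) => [|n IH]; rewrite ?big_ord0 // big_ord_recr /= IH uphalf_half addnC.
by apply: (@def_sum _ (fun i _ => odd i : nat));
  [|apply: (defb_odd (F := fun e => e 0))]; apply: def_var.
Qed.

(** [Cantor.to_nat (x, y)] is [y] plus the triangular number of [y + x], which is a primitive
    recursion. *)
Lemma def_pair F G :
  def A F -> def A G -> def A (fun e => Cantor.to_nat (F e, G e)).
Proof.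
move=> dF dG; apply: def_add => //.
apply: (def_rec (S := fun i m _ => i.+1 + m)).
- exact: def_add.
- exact: def0.
- by apply: def_add; [apply: defS|]; apply: def_var.
Qed.

(** Both coordinates are bounded by the code, so a bounded double sum in which only the true pair
    contributes does the decoding. *)
Lemma def_unpair (g : nat -> nat -> nat) F :
  def A (fun e => g (e 0) (e 1)) -> def A F ->
  def A (fun e => let: (x, y) := Cantor.of_nat (F e) in g x y).
Proof.
move=> dg; apply: (@def_app1 (fun z => let: (x, y) := Cantor.of_nat z in g x y)).
pose T z x y := (Cantor.to_nat (x, y) == z) * g x y.
apply: (def_ext (F := fun e => \sum_(x < (e 0).+1) \sum_(y < (e 0).+1) T (e 0) x y)).
  move=> e; case E: (Cantor.of_nat (e 0)) => [x y].
  have Ez : Cantor.to_nat (x, y) = e 0 by rewrite -E Cantor.cancel_to_of.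
  have le : y + x <= e 0 by rewrite -Ez; apply/leP; apply: Cantor.to_nat_non_decreasing.
  have lx : x < (e 0).+1 by lia.
  have ly : y < (e 0).+1 by lia.
  have T0 i j : (i, j) <> (x, y) -> T (e 0) i j = 0.
    by move=> ne; rewrite /T -Ez; case: eqP => // /Cantor.to_nat_inj.
  rewrite (bigD1 (Ordinal lx)) //= (bigD1 (Ordinal ly)) //= {1}/T Ez eqxx mul1n.
  rewrite !big1 ?addn0 // => [i ne|j ne].
    apply: big1 => j _; apply: T0 => -[Ei _]; move/eqP: ne; apply; exact: val_inj.
  by apply: T0 => -[Ej]; move/eqP: ne; apply; exact: val_inj.
apply: (@def_sum _ (fun x e => \sum_(y < (e 0).+1) T (e 0) x y)).
  by apply: defS; apply: def_var.
apply: (@def_sum _ (fun y e => T (e 1) (e 0) y)).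
  by apply: defS; apply: def_var.
apply: (@def_mul (fun e => Cantor.to_nat (e 1, e 0) == e 2 : nat)
                 (fun e => g (e 1) (e 0))).
  apply: (@defb_eq (fun e => Cantor.to_nat (e 1, e 0))); last exact: def_var.
  by apply: (@def_pair (fun e => e 1)); apply: def_var.
exact: (def_ren (fun i => if i is 0 then 1 else 0) dg).
Qed.

Lemma def_fst F : def A F -> def A (fun e => (Cantor.of_nat (F e)).1).
Proof.
move=> dF; apply: def_ext (@def_unpair (fun x _ => x) _ _ dF); last exact: def_var.
by move=> e; case: Cantor.of_nat.
Qed.

Lemma def_snd F : def A F -> def A (fun e => (Cantor.of_nat (F e)).2).
Proof.
move=> dF; apply: def_ext (@def_unpair (fun _ y => y) _ _ dF); last exact: def_var.
by move=> e; case: Cantor.of_nat.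
Qed.

Lemma defb_all (I : Type) (s : seq I) (b : I -> (nat -> nat) -> bool) :
  (forall i, def A (fun e => b i e : nat)) -> def A (fun e => all (b^~ e) s : nat).
Proof.
move=> db; elim: s => [|i s IH] /=; first exact: def_const.
exact: defb_and.
Qed.

(** A case distinction over finitely many values is a sum weighted by indicators, so each value [a]
    can be treated as a constant. *)
Lemma def_fin (X : finType) (x : (nat -> nat) -> X) (F : X -> (nat -> nat) -> nat) :
  (forall a, def A (fun e => x e == a : nat)) -> (forall a, def A (F a)) ->
  def A (fun e => F (x e) e).
Proof.
move=> dx dF.
apply: (def_ext (F := fun e => \sum_(a : X) (x e == a) * F a e)) => [e|].
  rewrite (bigD1 (x e)) //= eqxx mul1n big1 ?addn0 // => a.
  by rewrite eq_sym => /negbTE ->.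
elim: (index_enum X) => [|a s IH].
  by apply: def_ext (def0 A) => e; rewrite big_nil.
apply: (def_ext (F := fun e => (x e == a) * F a e + \sum_(i <- s) (x e == i) * F i e)).
  by move=> e; rewrite big_cons.
by apply: def_add => //; apply: def_mul.
Qed.

End Arith.

(** * Simulation of Turing machines *)

Definition pack (s : seq nat) : nat := foldr (fun a c => Cantor.to_nat (a, c)) 0 s.

Fixpoint unpack (i c : nat) : nat :=
  if i is j.+1 then unpack j (Cantor.of_nat c).2 else (Cantor.of_nat c).1.

Arguments unpack : simpl never.

Lemma unpackK s i : i < size s -> unpack i (pack s) = nth 0 s i.
Proof.
elim: s i => [//|a s IH] i lt; rewrite -[pack _]/(Cantor.to_nat (a, pack s)).
by case: i lt => [|i] lt; rewrite /unpack -/unpack Cantor.cancel_of_to //= IH.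
Qed.

(* Binary code, so that the blanks ending a tape are invisible. *)
Definition code (l : seq bool) : nat := foldr (fun (b : bool) n => b + n.*2) 0 l.

Lemma code_head l : odd (code l) = head false l.
Proof. by case: l => //= b l; rewrite oddD odd_double addbF oddb. Qed.

Lemma code_behead l : (code l)./2 = code (behead l).
Proof. by case: l => //= b l; rewrite half_bit_double. Qed.

(** Strokes are the binary digits 1 of the code, and a number [m] has no such digit at positions
    from [m] on. *)
Lemma code_strokes l n : code l <= n -> \sum_(i < n) odd (iter i half (code l)) = count id l.
Proof.
elim: l n => [|b l IH] n /= le.
  suff H j : iter j half 0 = 0 by rewrite big1 // => i _; rewrite H.
  by elim: j => //= j ->.
case: n le => [|n] le.
  have l0 : code l = 0 by lia.
  have b0 : b = false by lia.
  by rewrite b0 -(IH 0) ?l0 ?big_ord0.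
rewrite big_ord_recl /= oddD odd_double addbF oddb -(IH n); last by lia.
by congr (_ + _); apply: eq_bigr => i _; rewrite add0n -iterS iterSr half_bit_double.
Qed.

Section Simulation.
Variable M : machine.
Let k := extra M.
Let X : finType := (state M * option bool * {ffun 'I_k.+1 -> bool})%type.

(** The head position is split into two naturals; it lies on the written side of the oracle tape iff
    [neg_part] vanishes. *)
Definition pos_part (z : int) : nat := if z is Posz n then n else 0.
Definition neg_part (z : int) : nat := if z is Negz n then n.+1 else 0.

(* The components of a configuration: state, position of the oracle head and,
   from index 3 on, the left and right halves of the tapes in turn. *)
Definition comps (c : config M) (j : nat) : nat :=
  match j with
  | 0 => enum_rank (cur c)
  | 1 => pos_part (opos c)
  | 2 => neg_part (opos c)
  | i.+3 => let t := work c (inord i./2) in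
            if odd i then code t.2 else code t.1
  end.

Definition encode (c : config M) : nat := pack (mkseq (comps c) (k.+1.*2 + 3)).

Lemma unpack_encode c j : j < k.+1.*2 + 3 -> unpack j (encode c) = comps c j.
Proof. by move=> lt; rewrite unpackK ?size_mkseq // nth_mkseq. Qed.

Lemma unpack_left c (i : 'I_k.+1) : unpack (i.*2 + 3) (encode c) = code (work c i).1.
Proof.
have lti := ltn_ord i; rewrite unpack_encode; last by lia.
by rewrite addn3 /= odd_double doubleK inord_val.
Qed.

Lemma unpack_right c (i : 'I_k.+1) : unpack (i.*2 + 4) (encode c) = code (work c i).2.
Proof.
have lti := ltn_ord i; rewrite unpack_encode; last by lia.
by rewrite addn4 /= odd_double uphalf_double inord_val.
Qed.

(** What the machine sees, read off a code. It takes finitely many values, which makes a step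
    definable by cases; the default state never matters on codes of configurations. *)
Definition scan (A : set nat) (z : nat) : X :=
  (nth (start M) (enum (state M)) (unpack 0 z),
   if unpack 2 z == 0 then Some (unpack 1 z \in A) else None,
   [ffun i : 'I_k.+1 => odd (unpack (i.*2 + 4) z)]).

Definition table (x : X) := trans x.1.1 x.1.2 x.2.

Lemma scan_encode A c :
  scan A (encode c) =
  (cur c, oracle_symbol A (opos c), [ffun i => read (work c i)]).
Proof.
rewrite /scan !unpack_encode; [|lia..]; congr (_, _, _).
- by rewrite /= nth_enum_rank.
- by rewrite /= /oracle_symbol; case: (opos c).
- by apply/ffunP => i; rewrite !ffunE unpack_right code_head.
Qed.

(** A halted configuration is repeated forever, so an outcome persists at all later times. *)
Definition next (A : set nat) (c : config M) : config M := odflt c (step A c).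

(** Once [x] is fixed, the table entry is a constant and each component is elementary arithmetic:
    writing replaces the lowest bit, and moving the head halves one side and doubles the other. *)
Definition next_comp (x : X) (j z : nat) : nat :=
  if table x is Some (q, w, m) then
    match j with
    | 0 => enum_rank q
    | 1 => match m with
           | Left => (unpack 1 z).-1
           | Stay => unpack 1 z
           | Right => if unpack 2 z == 0 then (unpack 1 z).+1 else 0
           end
    | 2 => match m with
           | Left => if unpack 1 z == 0 then (unpack 2 z).+1 else 0
           | Stay => unpack 2 z
           | Right => (unpack 2 z).-1
           end
    | i.+3 =>
        let h : 'I_k.+1 := inord i./2 in
        let l := unpack (h.*2 + 3) z in
        let r := (w h).1 + (unpack (h.*2 + 4) z)./2.*2 in
        if odd i then
          match (w h).2 with
          | Left => odd l + r.*2
          | Stay => r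
          | Right => r./2
          end
        else
          match (w h).2 with
          | Left => l./2
          | Stay => l
          | Right => odd r + l.*2
          end
    end
  else unpack j z.

Definition next_code A z : nat :=
  pack (mkseq (fun j => next_comp (scan A z) j z) (k.+1.*2 + 3)).

Lemma next_code_encode A c : next_code A (encode c) = encode (next A c).
Proof.
congr pack; apply/eq_in_map => j; rewrite mem_iota add0n => /andP [_ ltj].
rewrite /next_comp scan_encode /next /step /table /=.
case E: trans => [[[q w] m]|]; last by rewrite unpack_encode.
case: j ltj => [//|[|[|i]]] ltj.
- rewrite !unpack_encode; [|lia..].
  by case: m {E} => //=; case: (opos c) => [[|n]|[|n]] //=; lia.
- rewrite !unpack_encode; [|lia..].
  by case: m {E} => //=; case: (opos c) => [[|n]|[|n]] //=; lia.
rewrite unpack_left unpack_right /= ffunE; set h : 'I_k.+1 := inord _.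
rewrite code_behead.
case: (work c h) => l r; case: (w h) => b [] /=; case: (odd i) => //=;
  by rewrite ?code_head ?code_behead // ?half_bit_double // ?oddD ?odd_double ?addbF ?oddb.
Qed.

(* [0] if [M] has not halted on [x] after [t] steps, and the successor of its
   output otherwise. *)
Definition sim (A : set nat) (x t : nat) : nat :=
  let c := iter t (next A) (init M x) in
  if step A c is None then (strokes (work c ord0)).+1 else 0.

Lemma iter_next A t c d : run A t c = Some d -> iter t (next A) c = d.
Proof.
elim: t c => [|t IH] c /=; first by case.
by rewrite -iterS iterSr /next; case: (step A c) => //= c' /IH.
Qed.

Lemma iter_next_run A t c : exists2 s, s <= t & run A s c = Some (iter t (next A) c).
Proof.
elim: t => [|t [s le Rs]]; first by exists 0.
rewrite iterS /next; case E: (step A _) => [d|] /=.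
  by exists s.+1; rewrite // -addn1 run_add Rs /= E.
by exists s => //; apply: leqW.
Qed.

Lemma sim_outputs A x y : outputs M A x y <-> exists t, sim A x t = y.+1.
Proof.
split=> [[t [c [Rt cN <-]]]|[t]].
  by exists t; rewrite /sim (iter_next Rt) cN.
rewrite /sim; case E: step => [//|] -[<-].
have [s _ Rs] := iter_next_run A t (init M x).
by exists s, (iter t (next A) (init M x)).
Qed.

Lemma sim_mono A x t t' y : t <= t' -> sim A x t = y.+1 -> sim A x t' = y.+1.
Proof.
move=> le; rewrite -(subnK le) /sim iterD; set c := iter t _ _.
case E: (step A c) => [//|] H.
suff -> : iter (t' - t) (next A) c = c by rewrite E.
by elim: (t' - t) => //= n ->; rewrite /next E.
Qed.

(** Components 3 and 4 code the two halves of tape 0, whose strokes form the output. *)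
Definition sim_code A x t : nat :=
  let z := iter t (next_code A) x in
  if table (scan A z) is None then
    (\sum_(i < unpack 3 z) odd (iter i half (unpack 3 z)) +
     \sum_(i < unpack 4 z) odd (iter i half (unpack 4 z))).+1
  else 0.

Lemma sim_codeE A x t : sim A x t = sim_code A (encode (init M x)) t.
Proof.
rewrite /sim /sim_code.
have -> : iter t (next_code A) (encode (init M x)) = encode (iter t (next A) (init M x)).
  by elim: t => //= t ->; rewrite next_code_encode.
move: (iter t _ _) => c; rewrite scan_encode /table /step /=.
case: trans => [[[q w] m]//|].
by rewrite (unpack_left c ord0) (unpack_right c ord0) !code_strokes.
Qed.

(* The head moves by one cell at a time, so that [t] steps only explore the
   first [t] cells of the oracle. *)
Lemma sim_local A B x t :
  (forall i, i < t -> (i \in A) = (i \in B)) -> forall s, s < t -> sim A x s = sim B x s.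
Proof.
move=> AB s lst.
have pos u : pos_part (opos (iter u (next A) (init M x))) <= u.
  elim: u => [//|u]; rewrite iterS; move: (iter u _ _) => c.
  rewrite /next /step; case: trans => [[[q w] m]|] //=; last by move=> /leqW.
  by case: m => //=; case: (opos c) => [[|n]|[|n]] //=; lia.
have symb u : u < t -> let c := iter u (next A) (init M x) in step A c = step B c.
  move=> lut c; rewrite /step.
  suff -> : oracle_symbol A (opos c) = oracle_symbol B (opos c) by [].
  have := pos u; rewrite -/c; case: (opos c) => //= n le.
  by rewrite AB // (leq_ltn_trans le).
have same u : u <= t -> iter u (next A) (init M x) = iter u (next B) (init M x).
  elim: u => [//|u IH] lut; rewrite !iterS -IH 1?ltnW //.
  by rewrite {1}/next symb.
by rewrite /sim -same 1?ltnW // symb.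
Qed.

End Simulation.

(** * Definability of the simulation *)

Section DefSim.
Variable B : set nat.

Lemma def_unpack i F : def B F -> def B (fun e => unpack i (F e)).
Proof. by elim: i F => [|i IH] F dF; [apply: def_fst | apply/IH/def_snd]. Qed.

Lemma def_pack (F : nat -> (nat -> nat) -> nat) n : (forall j, def B (F j)) ->
  def B (fun e => pack (mkseq (fun j => F j e) n)).
Proof.
move=> dF; rewrite /mkseq; elim: (iota 0 n) => [|j s IH]; first exact: def0.
exact: def_pair.
Qed.

Lemma def_code_ones F : def B F -> def B (fun e => code (nseq (F e) true)).
Proof.
apply: (@def_app1 B (fun n => code (nseq n true))).
apply: (@def_ext B (fun e => iteri (e 0) (fun _ v => 1 + (v + v)) 0)) => [e|].
  by elim: (e 0) => //= n ->; rewrite addnn.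
by apply: def_rec; do ?apply: def_add; do ?[apply: def_const|apply: def_var].
Qed.

(** The simulated oracle may vary with the environment, as the stages of an enumeration do; it is
    distinct from the ambient oracle [B]. *)
Definition def_set (As : (nat -> nat) -> set nat) : Prop :=
  def B (fun e => (e 0 \in As (fun j => e j.+1)) : nat).

Lemma def_mem As F : def_set As -> def B F -> def B (fun e => (F e \in As e) : nat).
Proof. by move=> dA dF; apply: (def_let dF dA). Qed.

Lemma def_set_ren As s : def_set As -> def_set (fun e => As (fun j => e (s j))).
Proof. exact: (def_ren (fun i => if i is j.+1 then (s j).+1 else 0)). Qed.

Lemma def_nth d s F : def B F -> def B (fun e => nth d s (F e)).
Proof.
elim: s F => [|a s IH] F dF.
  by apply: (@def_ext B (fun=> d)) => [e|]; [rewrite nth_nil | apply: def_const].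
apply: (@def_ext B (fun e => if F e == 0 then a else nth d s (F e).-1)) => [e|].
  by case: (F e).
apply: def_if; first by apply: defb_eq => //; apply: def0.
  exact: def_const.
by apply: IH; apply: def_pred.
Qed.

Lemma defb_eqb (b : (nat -> nat) -> bool) (c : bool) :
  def B (fun e => b e : nat) -> def B (fun e => (b e == c) : nat).
Proof.
move=> db; case: c.
  by apply: (@def_ext B (fun e => b e)) db => e; rewrite eqb_id.
by apply: (@def_ext B (fun e => ~~ b e)) => [e|]; [rewrite eqbF_neg | apply: defb_neg].
Qed.

Variable M : machine.

Lemma defb_scan As F x : def_set As -> def B F ->
  def B (fun e => (scan M (As e) (F e) == x) : nat).
Proof.
move=> dA dF; case: x => [[q o] r]; rewrite /scan.
pose b1 e := nth (start M) (enum (state M)) (unpack 0 (F e)) == q.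
pose b2 e := (if unpack 2 (F e) == 0 then Some (unpack 1 (F e) \in As e) else None) == o.
pose b3 e := [ffun i : 'I_(extra M).+1 => odd (unpack (i.*2 + 4) (F e))] == r.
apply: (@def_ext B (fun e => b1 e && b2 e && b3 e)) => //.
apply: defb_and; first apply: defb_and.
- pose s := [seq (a == q : nat) | a <- enum (state M)].
  apply: (@def_ext B (fun e => nth (start M == q : nat) s (unpack 0 (F e))) b1) => [e|].
    rewrite /b1.
    case: (ltnP (unpack 0 (F e)) (size (enum (state M)))) => lt.
      by rewrite (nth_map (start M)).
    by rewrite nth_default ?size_map -?enumT // nth_default -?enumT.
  by apply: def_nth; apply: def_unpack.
- have d2 : def B (fun e => (unpack 2 (F e) == 0) : nat).
    by apply: defb_eq; [apply: def_unpack | apply: def0].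
  case: o @b2 => [b|] b2.
    apply: (@def_ext B (fun e => (unpack 2 (F e) == 0) && ((unpack 1 (F e) \in As e) == b)) b2).
      by move=> e; rewrite /b2; case: (unpack 2 _ == 0).
    apply: defb_and => //; apply: defb_eqb; apply: def_mem => //; exact: def_unpack.
  apply: (@def_ext B (fun e => ~~ (unpack 2 (F e) == 0)) b2); last exact: defb_neg.
  by move=> e; rewrite /b2; case: (unpack 2 _ == 0).
apply: (@def_ext B (fun e => all (fun i : 'I_(extra M).+1 =>
    odd (unpack (i.*2 + 4) (F e)) == r i) (enum 'I_(extra M).+1)) b3) => [e|].
  rewrite /b3.
  congr nat_of_bool; apply/allP/eqP => [H|<- i _]; last by rewrite ffunE.
  by apply/ffunP => i; rewrite ffunE; apply/eqP/H; rewrite mem_enum.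
apply: (@defb_all B _ _ (fun (i : 'I_(extra M).+1) e => odd (unpack (i.*2 + 4) (F e)) == r i)).
by move=> i; apply: defb_eqb; apply: defb_odd; apply: def_unpack.
Qed.

Lemma def_next_comp x j F : def B F -> def B (fun e => @next_comp M x j (F e)).
Proof.
move=> dF; rewrite /next_comp.
case: (table x) => [[[q w] m]|]; last exact: def_unpack.
have dU i := @def_unpack i _ dF.
have dE i : def B (fun e => (unpack i (F e) == 0) : nat).
  by apply: defb_eq => //; apply: def0.
case: j => [|[|[|i]]].
- exact: def_const.
- by case: m; [apply: def_pred | | apply: def_if; [|apply: defS|apply: def0]].
- by case: m; [apply: def_if; [|apply: defS|apply: def0] | | apply: def_pred].
set h : 'I__ := inord _; case: (w h) => b m' /=.
pose R e := b + (unpack (h.*2 + 4) (F e))./2.*2.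
have dD G : def B G -> def B (fun e => (G e).*2).
  move=> dG; apply: (@def_ext B (fun e => G e + G e)) => [e|]; last exact: def_add.
  by rewrite addnn.
have dR : def B R by apply: def_add; [apply: def_const | apply/dD/def_half].
case: (odd i); case: m'.
- by apply: def_add; [apply: defb_odd | apply: dD].
- exact: dR.
- exact: (def_half dR).
- exact: def_half.
- by [].
- by apply: def_add; [apply: (defb_odd dR) | apply: dD].
Qed.

Lemma def_next_code As F : def_set As -> def B F ->
  def B (fun e => next_code M (As e) (F e)).
Proof.
move=> dA dF; apply: def_pack => j.
apply: (@def_fin B _ (fun e => scan M (As e) (F e)) (fun x e => @next_comp M x j (F e))).
  by move=> x; apply: defb_scan.
by move=> x; apply: def_next_comp.
Qed.

Lemma def_encode_init F : def B F -> def B (fun e => encode (init M (F e))).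
Proof.
move=> dF; apply: def_pack => -[|[|[|i]]]; do ?exact: def_const.
  exact: (@def_const B (enum_rank (start M))).
pose h : 'I_(extra M).+1 := inord i./2.
apply: (@def_ext B (fun e => if (h == ord0) && odd i then code (nseq (F e).+1 true) else 0)
  (fun e => comps (init M (F e)) i.+3)).
  move=> e; pose t := work (init M (F e)) h.
  rewrite -[RHS]/(if odd i then code t.2 else code t.1) /t ffunE.
  by case: eqP => _; case: (odd i).
case: ((h == ord0) && odd i); [apply: (def_code_ones (defS dF)) | exact: def0].
Qed.

Lemma def_strokes_code F : def B F ->
  def B (fun e => \sum_(i < F e) odd (iter i half (F e))).
Proof.
move=> dF; apply: (@def_sum B F (fun i e => odd (iter i half (F e)) : nat)) => //.
apply: defb_odd.
apply: (@def_ext B (fun e => iteri (e 0) (fun _ v => v./2) (F (fun j => e j.+1)))) => [e|].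
  by elim: (e 0) => //= n ->.
apply: def_rec; [exact: def_var | exact: (def_ren succn dF) |].
by apply: def_half; apply: def_var.
Qed.

Lemma def_sim As F T : def_set As -> def B F -> def B T ->
  def B (fun e => sim M (As e) (F e) (T e)).
Proof.
move=> dA dF dT; apply: (@def_ext B (fun e => sim_code M (As e) (encode (init M (F e))) (T e))).
  by move=> e; rewrite sim_codeE.
rewrite /sim_code.
set Z := fun e => iter (T e) (next_code M (As e)) (encode (init M (F e))).
have dZ : def B Z.
  apply: (@def_ext B (fun e => iteri (T e) (fun _ => next_code M (As e))
                                 (encode (init M (F e))))) => [e|].
    by rewrite /Z; elim: (T e) => //= n ->.
  apply: def_rec => //; first exact: def_encode_init.
  by apply: def_next_code; [apply: def_set_ren | apply: def_var].
pose S e := (\sum_(i < unpack 3 (Z e)) odd (iter i half (unpack 3 (Z e))) +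
             \sum_(i < unpack 4 (Z e)) odd (iter i half (unpack 4 (Z e)))).+1.
have dS : def B S.
  by apply/defS/def_add; apply: (def_strokes_code (def_unpack _ dZ)).
apply: (@def_fin B _ (fun e => scan M (As e) (Z e))
  (fun x e => if table x is None then S e else 0)).
  by move=> x; apply: defb_scan.
by move=> x; case: (table x) => [_|//]; apply: def0.
Qed.

End DefSim.

(** * The s-m-n and recursion theorems for domains *)

Lemma def_app3 B (g : nat -> nat -> nat -> nat) F G H :
  def B (fun e => g (e 0) (e 1) (e 2)) -> def B F -> def B G -> def B H ->
  def B (fun e => g (F e) (G e) (H e)).
Proof.
move=> dg dF dG dH.
have d1 : def B (fun e => g (F (fun j => e j.+2)) (e 0) (e 1)).
  exact: (def_let (def_ren (fun j => j.+2) dF) dg).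
have d2 : def B (fun e => g (F (fun j => e j.+1)) (G (fun j => e j.+1)) (e 0)).
  exact: (def_let (def_ren succn dG) d1).
exact: (def_let dH d2).
Qed.

Lemma def_app4 B (g : nat -> nat -> nat -> nat -> nat) F G H I :
  def B (fun e => g (e 0) (e 1) (e 2) (e 3)) ->
  def B F -> def B G -> def B H -> def B I ->
  def B (fun e => g (F e) (G e) (H e) (I e)).
Proof.
move=> dg dF dG dH dI.
have d1 : def B (fun e => g (F (fun j => e j.+3)) (e 0) (e 1) (e 2)).
  exact: (def_let (def_ren (fun j => j.+3) dF) dg).
have d2 : def B (fun e => g (F (fun j => e j.+2)) (G (fun j => e j.+2)) (e 0) (e 1)).
  exact: (def_let (def_ren (fun j => j.+2) dG) d1).
have d3 : def B (fun e => g (F (fun j => e j.+1)) (G (fun j => e j.+1))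
                            (H (fun j => e j.+1)) (e 0)).
  exact: (def_let (def_ren succn dH) d2).
exact: (def_let dI d3).
Qed.

(* [R x t] is the successor of the value of [f] at [x] if that value is found
   within [t] steps, and [0] otherwise. *)
Record staged (f : pfun) (R : nat -> nat -> nat) : Prop := Staged {
  staged_def : forall B, def B (fun e => R (e 0) (e 1));
  stagedP : forall x y, f x = Some y <-> exists t, R x t = y.+1;
  staged_mono : forall x y t t', t <= t' -> R x t = y.+1 -> R x t' = y.+1
}.

Lemma partial_computable_staged f : partial_computable f -> exists R, staged f R.
Proof.
case=> M Mf; exists (sim M set0); split; last by move=> x y t t'; apply: sim_mono.
  move=> B; apply: (@def_sim B M (fun _ => set0)); try exact: def_var.
  apply: (@def_ext B (fun _ => 0)); last exact: def0.
  by move=> e; rewrite in_set0.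
by move=> x y; rewrite Mf sim_outputs.
Qed.

Lemma staged_None f R x : staged f R -> f x = None <-> forall t, R x t = 0.
Proof.
move=> [_ fR _]; split=> [fx t|R0].
  by case E: (R x t) => [//|y]; have /fR : exists t, R x t = y.+1 by [exists t]; rewrite fx.
by case E: (f x) => [y|//]; move/fR: E => [t]; rewrite R0.
Qed.

Section Numbering.
Variable phi : nat -> pfun.
Hypothesis phi_acc : acceptable phi.

Lemma phi_staged : exists2 E : nat -> nat -> nat -> nat,
  forall B, def B (fun e => E (e 0) (e 1) (e 2)) &
  forall e, staged (phi e) (E e).
Proof.
have [R sR] := partial_computable_staged (acceptable_enum phi_acc).
have dR B := @def_app2 B R _ _ (staged_def sR B).
exists (fun e x => R (Cantor.to_nat (e, x))) => [B|e].
  by apply: dR; [apply: (@def_pair B (fun e => e 0))|]; apply: def_var.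
split.
- by move=> B; apply: dR; [apply: (@def_pair B (fun=> e)); [apply: def_const|]|]; apply: def_var.
- by move=> x y; rewrite -(stagedP sR) Cantor.cancel_of_to.
- by move=> x y; apply: (staged_mono sR).
Qed.

(** Searching for [c] and returning 0 is partial computable in [w] and [z], so the parametrization
    theorem applies. *)
Lemma smn_domain (T : nat -> nat -> nat -> nat) :
  def set0 (fun e => T (e 0) (e 1) (e 2)) ->
  exists2 s, computable s &
    forall w z, W phi (s w) z <-> exists c, T w z c <> 0.
Proof.
move=> dT.
pose g w : pfun := fun z => if `[< exists c, T w z c <> 0 >] then Some 0 else None.
have [|s sc sg] := acceptable_smn phi_acc (g := g); last first.
  exists s => // w z; rewrite /W /= sg /g; case: asboolP => H; last by split.
  by split.
pose R x c := ~~ (T (Cantor.of_nat x).1 (Cantor.of_nat x).2 c == 0) : nat.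
apply: (@search_computable set0 R) => [|x y].
  apply: defb_neg; apply: defb_eq; last exact: def0.
  by apply: (def_app3 dT); [apply: def_fst|apply: def_snd|]; apply: def_var.
rewrite /R; case: (Cantor.of_nat x) => w z /=; rewrite /g; case: asboolP => H.
  split=> [[<-]|[c]]; last by case: eqP => //= _ [<-].
  by have [c Tc] := H; exists c; case: eqP.
by split=> // -[c]; case: eqP => // Tc; case: H; exists c.
Qed.

Lemma index_of s : computable s -> exists u, phi u = pfun_of s.
Proof.
move=> /partial_computable_staged [R sR].
have [|i _ H] := acceptable_smn phi_acc (g := fun _ => pfun_of s); last by exists (i 0).
apply: (@search_computable set0 (fun z => R (Cantor.of_nat z).2)) => [|x y].
  by apply: (@def_app2 _ R _ _ (staged_def sR _)); [apply: def_snd|]; apply: def_var.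
by rewrite -(stagedP sR); case: Cantor.of_nat.
Qed.

Lemma computable_pairl s u : computable s -> computable (fun p => s (Cantor.to_nat (u, p))).
Proof.
move=> /partial_computable_staged [R sR].
apply: (@search_computable set0 (fun p => R (Cantor.to_nat (u, p)))) => [|x y].
  apply: (@def_app2 _ R _ _ (staged_def sR _)); last exact: def_var.
  by apply: (@def_pair _ (fun=> u)); [apply: def_const | apply: def_var].
by rewrite -(stagedP sR).
Qed.

Lemma computable_pairr s u : computable s -> computable (fun p => s (Cantor.to_nat (p, u))).
Proof.
move=> /partial_computable_staged [R sR].
apply: (@search_computable set0 (fun p => R (Cantor.to_nat (p, u)))) => [|x y].
  apply: (@def_app2 _ R _ _ (staged_def sR _)); last exact: def_var.
  by apply: (@def_pair _ _ (fun=> u)); [apply: def_var | apply: def_const].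
by rewrite -(stagedP sR).
Qed.

(* The fixed point at [p] is [s (u, p)], where [u] is an index of the s-m-n
   function [s] itself. *)
Lemma recursion_domain (T : nat -> nat -> nat -> nat -> nat) :
  def set0 (fun e => T (e 0) (e 1) (e 2) (e 3)) ->
  exists2 F, computable F &
    forall p z, W phi (F p) z <-> exists c, T (F p) p z c <> 0.
Proof.
move=> dT; have [E dE sE] := phi_staged.
(* With [w] coding [(u, p)], the function with index [u] is run on [w] itself. The witness [c] codes
   a time for this self-application and a witness for [T]. *)
pose T' w z c :=
  let v := E (Cantor.of_nat w).1 w (Cantor.of_nat c).1 in
  if v == 0 then 0 else T v.-1 (Cantor.of_nat w).2 z (Cantor.of_nat c).2.
have dv : def set0 (fun e => E (Cantor.of_nat (e 0)).1 (e 0) (Cantor.of_nat (e 2)).1).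
  by apply: (def_app3 (dE _)); do ?apply: def_fst; apply: def_var.
have [|s sc sT] := @smn_domain T'.
  apply: def_if; first by apply: defb_eq; [exact: dv | exact: def0].
    exact: def0.
  by apply: (def_app4 dT); first exact: def_pred dv; do ?apply: def_snd; apply: def_var.
have [u us] := index_of sc.
exists (fun p => s (Cantor.to_nat (u, p))); first exact: computable_pairl.
move=> p z; rewrite sT /T'; set w := Cantor.to_nat (u, p).
rewrite {1 3}/w Cantor.cancel_of_to /=.
have uw : phi u w = Some (s w) by rewrite us.
have Ev t v : E u w t = v.+1 -> v = s w.
  move=> Et; have /(stagedP (sE u)) : exists t, E u w t = v.+1 by exists t.
  by rewrite uw => -[].
split=> [[c]|[c Tc]].
  case Et: (E u w _) => [//|v] /=; rewrite (Ev _ _ Et) => Tc.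
  by exists (Cantor.of_nat c).2.
have /(stagedP (sE u)) [t Et] := uw.
by exists (Cantor.to_nat (t, c)); rewrite Cantor.cancel_of_to /= Et.
Qed.

End Numbering.

(** * The construction *)

Section Fixed.
Variable phi : nat -> pfun.
Hypothesis phi_acc : acceptable phi.
Variable E : nat -> nat -> nat -> nat.
Hypothesis E_def : forall B, def B (fun e => E (e 0) (e 1) (e 2)).
Hypothesis E_staged : forall e, staged (phi e) (E e).
Variable a : nat.
Let A := W phi a.
Variables (M : machine) (delta : pfun).
Hypothesis M_delta : computes M A delta.
Hypothesis delta_fpf : fixed_point_free phi delta.
Variables (psi : pfun) (P : nat -> nat -> nat).
Hypothesis P_staged : staged psi P.

Definition enumerated (s : nat) : set nat := [set i | E a i s != 0].

Definition delta_approx (s k t : nat) : nat := sim M (enumerated s) k t.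

(* The stage reached before [psi n] converges, hence [s] as long as it does
   not. *)
Definition stage_before (n s : nat) : nat := \sum_(j < s) (P n j == 0).

(* The successor of the index to be copied by the index [k] of the pair [(n, x)]
   from stage [s] on, or [0] if there is none yet. The computation of [delta k]
   is given no more steps than were allowed when [psi n] converged: if it never
   disappears, then it is a computation with oracle [A]. *)
Definition chosen (k n x s : nat) : nat :=
  let d := delta_approx s k (stage_before n s) in
  if d == 0 then P n s else if E x x s == 0 then 0 else d.

(** The witness [c] codes a stage [s] and a time [t]. The sum forces [s] to be the first stage with
    a choice, so at most one set is copied. *)
Definition copy (k p z c : nat) : nat :=
  let n := (Cantor.of_nat p).1 in let x := (Cantor.of_nat p).2 in
  let s := (Cantor.of_nat c).1 in let t := (Cantor.of_nat c).2 in
  if (chosen k n x s == 0) || (\sum_(j < s) chosen k n x j != 0) then 0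
  else E (chosen k n x s).-1 z t.

Lemma mem_W e z : W phi e z <-> exists t, E e z t <> 0.
Proof.
rewrite /W /=; split=> [H|[t Et] /(staged_None _ (E_staged e)) E0]; last by rewrite E0 in Et.
apply: contrapT => nE; apply/H/(staged_None _ (E_staged e)) => t.
by apply: contrapT => Et; apply: nE; exists t.
Qed.

Lemma staged_neq0 f R x t t' : staged f R -> t <= t' -> R x t <> 0 -> R x t' <> 0.
Proof. by move=> sR le; case Et: (R x t) => [//|y] _; rewrite (staged_mono sR le Et). Qed.

Lemma enumerated_mono s s' i : s <= s' -> i \in enumerated s -> i \in enumerated s'.
Proof.
move=> le; rewrite !in_setE /enumerated /= => /eqP Es; apply/eqP.
exact: staged_neq0 (E_staged a) le Es.
Qed.

Lemma enumerated_sub s i : i \in enumerated s -> i \in A.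
Proof. by rewrite !in_setE /A => /eqP Es; apply/mem_W; exists s. Qed.

Definition agree s h := forall i, i <= h -> (i \in enumerated s) = (i \in A).

Lemma agree_mono s s' h : s <= s' -> agree s h -> agree s' h.
Proof.
move=> le H i /H Hi; apply/idP/idP => [/enumerated_sub //|].
by rewrite -Hi; apply: enumerated_mono.
Qed.

Lemma agree_exists h : exists s, agree s h.
Proof.
have one i : exists s, (i \in enumerated s) = (i \in A).
  case iA: (i \in A).
    have /set_mem/mem_W [t Et] : i \in A by [].
    by exists t; apply/mem_set/eqP.
  by exists 0; apply/negP => /enumerated_sub; rewrite iA.
elim: h => [|h [s Hs]].
  by have [s Es] := one 0; exists s => -[].
have [s' Es'] := one h.+1; exists (maxn s s') => i.
rewrite leq_eqVlt => /orP [/eqP ->|lt]; last by apply: agree_mono Hs _ lt; apply: leq_maxl.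
apply/idP/idP => [/enumerated_sub //|].
by rewrite -Es'; apply: enumerated_mono; apply: leq_maxr.
Qed.

(** Within [h] steps no oracle cell beyond [h] is read. *)
Lemma delta_approx_agree s k h : agree s h -> delta_approx s k h = sim M A k h.
Proof.
by move=> H; apply: (@sim_local _ _ _ _ h.+1) => // i; rewrite ltnS; apply: H.
Qed.

Lemma deltaP k y : delta k = Some y <-> exists h, sim M A k h = y.+1.
Proof. by rewrite M_delta sim_outputs. Qed.

Variable F : nat -> nat.
Hypothesis F_copy : forall p z, W phi (F p) z <-> exists c, copy (F p) p z c <> 0.
Let f x n := F (Cantor.to_nat (n, x)).
Let V x n s := chosen (f x n) n x s.

Lemma W_chosen x n s y : V x n s = y.+1 -> (forall j, j < s -> V x n j = 0) ->
  W phi (f x n) = W phi y.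
Proof.
move=> Vs V0; have Vz s' : \sum_(j < s') V x n j != 0 -> s < s'.
  rewrite leqNgt; apply: contra => le; apply/eqP/big1 => j _.
  by apply: V0; have := ltn_ord j; lia.
apply/predeqP => z; rewrite F_copy mem_W /copy Cantor.cancel_of_to /= -/(f x n).
split=> [[c]|[t Et]].
  case: (Cantor.of_nat c) => s' t /=; rewrite -/(V x n s').
  case: eqP => //= Vs'; case: ifP => // /negbFE/eqP Vs0 Et; exists t.
  suff -> : y = (V x n s').-1 by [].
  case: (ltngtP s s') => [lt|lt|<-]; last by rewrite Vs.
    move/eqP: Vs0; rewrite sum_nat_eq0 => /forallP /(_ (Ordinal lt)) /=.
    by rewrite -/(V x n s) Vs.
  by rewrite V0 in Vs'.
exists (Cantor.to_nat (s, t)); rewrite Cantor.cancel_of_to /= -/(V x n s) Vs /=.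
case: ifP => // H; have := Vz s; rewrite ltnn; by move=> /(_ H).
Qed.

(** Evidence, to be checked with the oracle, that [x] is outside the halting set. Since [psi n] has
    not converged before [h], the computation of [h] steps stays within the allowance at every stage
    from [s] on. *)
Definition certificate x n h s :=
  [/\ h <= s, delta_approx s (f x n) h <> 0, agree s h,
      forall j, j < h -> P n j = 0 & forall j, j <= s -> V x n j = 0].

Lemma stage_before_le n s h : h <= s -> (forall j, j < h -> P n j = 0) ->
  h <= stage_before n s.
Proof.
move=> le P0; rewrite /stage_before -(subnKC le) big_split_ord /=.
rewrite (eq_bigr (fun _ => 1)) => [|j _]; last by rewrite P0 //= ltn_ord.
by rewrite sum1_card card_ord leq_addr.
Qed.

Lemma stage_before_eq n s p : p <= s -> (forall j, j < p -> P n j = 0) -> P n p <> 0 ->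
  stage_before n s = p.
Proof.
move=> le P0 Pp; rewrite /stage_before -(subnKC le) big_split_ord /=.
rewrite (eq_bigr (fun _ => 1)) => [|j _]; last by rewrite P0 //= ltn_ord.
rewrite sum1_card card_ord big1 ?addn0 // => j _.
by case: eqP => // Pj; case: (staged_neq0 P_staged (leq_addr j p) Pp).
Qed.

(** From [s] on the computation is present at every stage with the value [y] of [delta (f x n)], so
    [psi n] can no longer be copied. If [x] entered the halting set, the first choice would be [y],
    against fixed point freeness. *)
Lemma certificate_notin x n h s : certificate x n h s -> ~ halting_set phi x.
Proof.
move=> [le Dh As Ph V0] /mem_W [s' Es'].
case Ey: (delta_approx s (f x n) h) Dh => [//|y] _.
have Ay := Ey; rewrite (delta_approx_agree _ As) in Ay.
have late j : s <= j -> delta_approx j (f x n) (stage_before n j) = y.+1.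
  move=> lej; apply: (sim_mono (stage_before_le (leq_trans le lej) Ph)).
  by rewrite -Ay -(delta_approx_agree _ (agree_mono lej As)).
have exV : exists j, V x n j != 0.
  exists (maxn s s'); rewrite /V /chosen late ?leq_maxl //=.
  by case: (E x x (maxn s s') =P 0) (staged_neq0 (E_staged x) (leq_maxr s s') Es').
case: (ex_minnP exV) => j /eqP Vj jmin.
have ltj : s < j by rewrite ltnNge; apply/negP => /V0.
apply: (@delta_fpf (f x n) y); first by apply/deltaP; exists h.
apply/esym/(@W_chosen _ _ j) => [|i lt].
  move: Vj; rewrite /V /chosen (late _ (ltnW ltj)) /=.
  by case: (E x x j == 0).
by apply/eqP; apply: contraTT lt => /jmin; rewrite -leqNgt.
Qed.

(** Nothing is ever chosen: as [x] never enters the halting set, a choice could only be [psi n], and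
    copying it would make [f x] correct at [n]. It remains to find [h]; the stage [s] then comes
    from [agree_exists]. *)
Lemma certificate_exists x n : ~ halting_set phi x ->
  ~ ((forall m, psi n = Some m -> W phi (f x n) = W phi m) /\
     (psi n = None -> delta (f x n) = None)) ->
  exists h s, certificate x n h s.
Proof.
move=> nK bad.
have K0 s : E x x s = 0 by apply: contrapT => Es; apply/nK/mem_W; exists s.
have VE s : V x n s = if delta_approx s (f x n) (stage_before n s) == 0 then P n s else 0.
  by rewrite /V /chosen K0 eqxx.
suff [h [[y Ay] Ph V0]] : exists h, [/\ exists y, sim M A (f x n) h = y.+1,
     forall j, j < h -> P n j = 0 & forall j, V x n j = 0].
  have [s0 As] := agree_exists h; exists h, (maxn s0 h).
  have As' := agree_mono (leq_maxl s0 h) As; split=> //; first exact: leq_maxr.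
  by rewrite (delta_approx_agree _ As') Ay.
case psin: (psi n) bad => [m|] bad.
  have exP : exists p, P n p != 0.
    by have /(stagedP P_staged) [t Pt] := psin; exists t; rewrite Pt.
  case: (ex_minnP exP) => p /eqP Pp pmin.
  have Pm j : P n j <> 0 -> P n j = m.+1.
    case Pj: (P n j) => [//|y] _.
    by have : psi n = Some y; [apply/(stagedP P_staged); exists j | rewrite psin => -[->]].
  have P0 j : j < p -> P n j = 0.
    by move=> lt; apply/eqP; apply: contraTT lt => /pmin; rewrite -leqNgt.
  have V0 j : V x n j = 0.
    apply: contrapT => Vj; have exV : exists j, V x n j != 0 by exists j; apply/eqP.
    case: (ex_minnP exV) => i /eqP Vi imin; apply: bad; split=> // _ [<-].
    apply: (@W_chosen _ _ i) => [|i' lt].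
      by move: Vi; rewrite VE; case: eqP => // _ /Pm.
    by apply/eqP; apply: contraTT lt => /imin; rewrite -leqNgt.
  (* The first stage [p] at which [psi n] has converged is the whole later allowance. At a stage
     with the right oracle up to [p] nothing is chosen although [psi n] has converged, so a
     computation of [p] steps must be present. *)
  exists p; split=> //.
  have [s0 As] := agree_exists p; pose s := maxn s0 p.
  have les : p <= s := leq_maxr s0 p.
  have := V0 s; rewrite VE (stage_before_eq les P0 Pp).
  rewrite (delta_approx_agree _ (agree_mono (leq_maxl s0 p) As)).
  case: (sim M A (f x n) p) => [/= Ps|y _]; last by exists y.
  by case: (staged_neq0 P_staged les Pp).
have P0 := (staged_None _ P_staged).1 psin.
(* If [psi n] diverges, failure means that [delta] is defined here; any time by which its
   computation has halted will do. *)
case dk: (delta (f x n)) bad => [y|] bad; last by case: bad.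
have /deltaP [h Ah] := dk; exists h; split; [by exists y | by [] |].
by move=> j; rewrite VE P0; case: ifP.
Qed.

End Fixed.

(** * Effectiveness of the construction *)

Section DefChosen.
Variable E : nat -> nat -> nat -> nat.
Hypothesis E_def : forall B, def B (fun e => E (e 0) (e 1) (e 2)).
Variables (a : nat) (M : machine) (P : nat -> nat -> nat).
Hypothesis P_def : forall B, def B (fun e => P (e 0) (e 1)).
Variable B : set nat.

Lemma def_enumerated S : def B S -> def_set B (fun e => enumerated E a (S e)).
Proof.
move=> dS; apply: (@def_ext B (fun e => ~~ (E a (e 0) (S (fun j => e j.+1)) == 0) : nat)).
  by move=> e; congr nat_of_bool; apply/idP/idP; rewrite in_setE.
apply: defb_neg; apply: defb_eq; last exact: def0.
by apply: (def_app3 (E_def B)); [exact: def_const|exact: def_var|exact: (def_ren succn dS)].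
Qed.

Lemma def_approx S K T : def B S -> def B K -> def B T ->
  def B (fun e => delta_approx E a M (S e) (K e) (T e)).
Proof. by move=> dS dK dT; apply: def_sim => //; apply: def_enumerated. Qed.

Lemma def_stage_before N S : def B N -> def B S ->
  def B (fun e => stage_before P (N e) (S e)).
Proof.
move=> dN dS; apply: (@def_sum B S (fun j e => (P (N e) j == 0) : nat)) => //.
apply: defb_eq; last exact: def0.
by apply: (def_app2 (P_def B)); [exact: (def_ren succn dN) | exact: def_var].
Qed.

Lemma def_chosen K N X S : def B K -> def B N -> def B X -> def B S ->
  def B (fun e => chosen E a M P (K e) (N e) (X e) (S e)).
Proof.
move=> dK dN dX dS.
have dd : def B (fun e => delta_approx E a M (S e) (K e) (stage_before P (N e) (S e))).
  by apply: def_approx => //; apply: def_stage_before.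
apply: def_if; first by apply: defb_eq; [exact: dd | exact: def0].
  exact: (def_app2 (P_def B)).
apply: def_if; [|exact: def0|exact: dd].
by apply: defb_eq; [apply: (def_app3 (E_def B)) | exact: def0].
Qed.

Lemma def_sum_chosen K N X S : def B K -> def B N -> def B X -> def B S ->
  def B (fun e => \sum_(j < S e) chosen E a M P (K e) (N e) (X e) j).
Proof.
move=> dK dN dX dS.
apply: (@def_sum B S (fun j e => chosen E a M P (K e) (N e) (X e) j)) => //.
apply: def_chosen; last exact: def_var.
- exact: (def_ren succn dK).
- exact: (def_ren succn dN).
- exact: (def_ren succn dX).
Qed.

Lemma def_copy : def B (fun e => copy E a M P (e 0) (e 1) (e 2) (e 3)).
Proof.
have dp (i : nat) : def B (fun e => (Cantor.of_nat (e i)).1) by apply: def_fst; apply: def_var.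
have dq (i : nat) : def B (fun e => (Cantor.of_nat (e i)).2) by apply: def_snd; apply: def_var.
have dc : def B (fun e => chosen E a M P (e 0) (Cantor.of_nat (e 1)).1
                            (Cantor.of_nat (e 1)).2 (Cantor.of_nat (e 3)).1).
  by apply: def_chosen => //; apply: def_var.
(* The disjunction guarding [copy] is unfolded into nested tests for zero, to which [def_if]
   applies. *)
apply: (@def_ext B (fun e =>
   if (chosen E a M P (e 0) (Cantor.of_nat (e 1)).1
         (Cantor.of_nat (e 1)).2 (Cantor.of_nat (e 3)).1 == 0) then 0 else
   if \sum_(j < (Cantor.of_nat (e 3)).1) chosen E a M P (e 0) (Cantor.of_nat (e 1)).1
         (Cantor.of_nat (e 1)).2 j == 0
   then E (chosen E a M P (e 0) (Cantor.of_nat (e 1)).1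
         (Cantor.of_nat (e 1)).2 (Cantor.of_nat (e 3)).1).-1 (e 2) (Cantor.of_nat (e 3)).2
   else 0)).
  by move=> e; rewrite /copy; case: (chosen _ _ _ _ _ _ _ _ == 0); case: (\sum_(_ < _) _ == 0).
apply: def_if; [by apply: defb_eq => //; apply: def0|exact: def0|].
apply: def_if; [|apply: (def_app3 (E_def B))|exact: def0].
- apply: defb_eq; last exact: def0.
  by apply: def_sum_chosen => //; apply: def_var.
- exact: def_pred dc.
- exact: def_var.
- exact: dq.
Qed.

End DefChosen.

(** * The procedure deciding the halting set from [A] *)

Section Decision.
Variable E : nat -> nat -> nat -> nat.
Hypothesis E_def : forall B, def B (fun e => E (e 0) (e 1) (e 2)).
Variables (a : nat) (A : set nat) (M : machine) (P R : nat -> nat -> nat).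
Hypothesis P_def : forall B, def B (fun e => P (e 0) (e 1)).
Hypothesis R_def : forall B, def B (fun e => R (e 0) (e 1)).

(* Whether a candidate [(n, h, s, t)] for a certificate is confirmed by the
   oracle; [R p t] gives the successor of the index of the pair [p]. *)
Definition confirms (x c : nat) : bool :=
  let n := unpack 0 c in let h := unpack 1 c in
  let s := unpack 2 c in let t := unpack 3 c in
  let r := R (Cantor.to_nat (n, x)) t in
  [&& ~~ (r == 0), h <= s, ~~ (delta_approx E a M s r.-1 h == 0),
      \sum_(i < h.+1) (((i : nat) \in A) - ((i : nat) \in enumerated E a s)) == 0,
      \sum_(j < h) P n j == 0 & \sum_(j < s.+1) chosen E a M P r.-1 n x j == 0].

(** In the format of [search_computable], 2 is the answer yes, 1 the answer no, and 0 means that [c]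
    settles nothing. *)
Definition decision (x c : nat) : nat :=
  if E x x (unpack 2 c) == 0 then confirms x c : nat else 2.

Lemma def_decision : def A (fun e => decision (e 0) (e 1)).
Proof.
have dc i : def A (fun e => unpack i (e 1)) by apply: def_unpack; apply: def_var.
have dx : def A (fun e => e 0) := def_var A 0.
have dr : def A (fun e => R (Cantor.to_nat (unpack 0 (e 1), e 0)) (unpack 3 (e 1))).
  by apply: (def_app2 (R_def A)) => //; apply: def_pair.
have dk := def_pred dr.
apply: def_if; [|rewrite /confirms; repeat apply: defb_and|exact: def_const].
- by apply: defb_eq; [apply: (def_app3 (E_def A)) | exact: def0].
- by apply: defb_neg; apply: defb_eq; [exact: dr | exact: def0].
- exact: defb_leq.
- apply: defb_neg; apply: defb_eq; last exact: def0.
  exact: def_approx.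
- apply: defb_eq; last exact: def0.
  apply: (@def_sum A (fun e => (unpack 1 (e 1)).+1)
    (fun i e => (i \in A) - (i \in enumerated E a (unpack 2 (e 1))))); first exact: defS.
  (* The oracle is consulted only here. *)
  apply: def_sub; first by apply: def_orc; apply: def_var.
  exact: (def_enumerated E_def a (dc 2)).
- apply: defb_eq; last exact: def0.
  apply: (@def_sum A (fun e => unpack 1 (e 1)) (fun i e => P (unpack 0 (e 1)) i)) => //.
  by apply: (def_app2 (P_def A)); [exact: (def_ren succn (dc 0)) | exact: def_var].
- apply: defb_eq; last exact: def0.
  by apply: def_sum_chosen => //; apply: defS.
Qed.

End Decision.

Theorem theorem5p1 (phi : nat -> pfun) (phi_acc : acceptable phi)
  (A : set nat) (A_ce : ce phi A) (A_lt : turing_lt A (halting_set phi))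
  (delta : pfun) (delta_A : partial_computable_in A delta)
  (delta_fpf : fixed_point_free phi delta)
  (psi : pfun) (psi_pc : partial_computable psi) :
  exists f : nat -> nat, computable f /\
    forall n : nat,
      (forall m : nat, psi n = Some m -> W phi (f n) = W phi m) /\
      (psi n = None -> delta (f n) = None).
Proof.
have [a Aa] := A_ce; have [M M_delta] := delta_A.
have [E E_def sE] := phi_staged phi_acc.
have [P sP] := partial_computable_staged psi_pc.
have P_def := staged_def sP.
(* The construction uses the enumeration of [A] but not [A] itself, so it is definable from the
   empty oracle and [F] is computable. *)
have [F F_comp FT] := recursion_domain phi_acc (def_copy E_def a M P_def set0).
have [R sR] := partial_computable_staged F_comp.
(* If no [f] works, the halting set reduces to [A], which [A_lt] forbids. *)
apply: contrapT => nof; case: A_lt => _; apply.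
rewrite Aa in M_delta *.
apply: (search_computable (def_decision E_def a (W phi a) M P_def (staged_def sR))).
have sumE n (G : nat -> nat) : \sum_(i < n) G i == 0 <-> forall i, i < n -> G i = 0.
  rewrite sum_nat_eq0; split=> [/forallP H i lt|H]; first exact/eqP/(H (Ordinal lt)).
  by apply/forallP => i; apply/eqP/H.
have FR p t k : R p t = k.+1 -> k = F p.
  move=> Rt; have /(stagedP sR) : exists t, R p t = k.+1 by exists t.
  by case.
have confE x c : confirms E a (W phi a) M P R x c -> ~ halting_set phi x.
  case/andP; case Rt: (R _ _) => [//|k] _ /= /and5P [le Dh As Ph V0].
  move: (FR _ _ _ Rt) => Ek; rewrite {}Ek in Dh V0.
  apply: (certificate_notin sE (a := a) M_delta delta_fpf FT
    (n := unpack 0 c) (h := unpack 1 c) (s := unpack 2 c)).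
  split=> //; first exact/eqP.
  (* Truncated subtraction detects only elements of [A] not yet enumerated; nothing outside [A] is
     ever enumerated. *)
  - move=> i lei; pose G i := ((i \in W phi a) - (i \in enumerated E a (unpack 2 c)) : nat).
    have := (sumE _ G).1 As i; rewrite ltnS => /(_ lei); rewrite /G.
    case iA: (i \in W phi a); case iE: (i \in enumerated _ _ _) => //= _.
    by rewrite (enumerated_sub sE iE) in iA.
  - exact/(sumE _ (P (unpack 0 c))).
  - by move=> j lej; apply: ((sumE _ _).1 V0).
have haltE x c : E x x (unpack 2 c) <> 0 -> halting_set phi x.
  by move=> Ec; apply/(mem_W sE); exists (unpack 2 c).
move=> x y; rewrite /pfun_of /decision.
have sound c y' : (if E x x (unpack 2 c) == 0 then confirms E a (W phi a) M P R x c : nat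
    else 2) = y'.+1 -> nat_of_bool (x \in halting_set phi) = y'.
  case: eqP => [_|/haltE xK].
    case Ec: (confirms _ _ _ _ _ _ _ _) => // -[<-].
    by case xK: (x \in _) => //; case: (confE _ _ Ec); apply/set_mem.
  by rewrite (mem_set xK) => -[].
split=> [[<-]|[c] /sound <-] //.
(* By [sound] every answer is right, so it remains to see that the search terminates for each
   [x]. *)
suff [c Hc] : exists c, (if E x x (unpack 2 c) == 0
    then confirms E a (W phi a) M P R x c : nat else 2) <> 0.
  by exists c; move: Hc (sound c); case: (if _ then _ else _) => // z _ /(_ _ erefl) ->.
case: (pselect (halting_set phi x)) => [/(mem_W sE) [s Es]|nK].
  exists (pack [:: 0; 0; s; 0]); rewrite unpackK //=; by case: eqP.
(* For this fixed [x], the computable function sending [n] to [F (n, x)] is a candidate for [f], so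
   it fails at some [n]. *)
have [n bad] : exists n, ~ ((forall m, psi n = Some m ->
      W phi (F (Cantor.to_nat (n, x))) = W phi m) /\
    (psi n = None -> delta (F (Cantor.to_nat (n, x))) = None)).
  apply: contrapT => good; apply: nof; exists (fun n => F (Cantor.to_nat (n, x))).
  split; first exact: computable_pairr.
  by move=> n; apply: contrapT => bad; apply: good; exists n.
have [h [s [le Dh As Ph V0]]] := certificate_exists sE M_delta sP FT nK bad.
have [t Rt] : exists t, R (Cantor.to_nat (n, x)) t = (F (Cantor.to_nat (n, x))).+1.
  exact/(stagedP sR).
exists (pack [:: n; h; s; t]); rewrite /confirms !unpackK //=.
have -> : E x x s = 0 by apply: contrapT => Es; apply/nK/(mem_W sE); exists s.
rewrite eqxx Rt /= le; move/eqP: Dh => -> /=.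
have -> : \sum_(i < h.+1) (((i : nat) \in W phi a) - ((i : nat) \in enumerated E a s)) == 0.
  apply/(sumE _ (fun i => (i \in W phi a) - (i \in enumerated E a s))) => i lt.
  by rewrite As ?subnn.
have -> : \sum_(j < h) P n j == 0 by apply/sumE.
suff -> : \sum_(j < s.+1) chosen E a M P (F (Cantor.to_nat (n, x))) n x j == 0 by [].
by apply/sumE.
Qed.
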